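(* Let $\mu,\nu,k$ be integers with $0\le k\le \mu<\nu$. Let $J_k^*:\mathcal{H}_{\mu+\nu-2k}\to\mathcal{H}_\mu\otimes\mathcal{H}_\nu$ be the Hilbert space adjoint of $J_k$ and let $1$ denote the constant function in $\mathcal{H}_{\mu+\nu-2k}$. Then $$J_k\big(J_k^*(1)\big)(0)=\frac{k!\,(\mu+\nu-2k+2)_k}{(-\nu)_k\,(-\mu)_k}.$$
   Context: For an integer $\tau\ge 0$, $\mathcal{H}_\tau$ is the space of polynomials in one complex variable of degree at most $\tau$, with inner product $\langle f,g\rangle=\int_{\mathbb{C}} f\,\overline{g}\,d\iota_\tau$, where $d\iota_\tau(z)=\frac{\tau+1}{(1+|z|^2)^{\tau}}\frac{dA(z)}{\pi(1+|z|^2)^2}$ and $dA$ is Lebesgue measure on $\mathbb{C}$. The tensor product $\mathcal{H}_\mu\otimes\mathcal{H}_\nu$ is realized as the space of polynomials $F(z,w)$ of degree $\le\mu$ in $z$ and $\le\nu$ in $w$ with the inner product of $L^2(d\iota_\mu(z)\,d\iota_\nu(w))$. The map $J_k:\mathcal{H}_\mu\otimes\mathcal{H}_\nu\to\mathcal{H}_{\mu+\nu-2k}$ is $$J_k(F)(\xi)=\int_{\mathbb{C}^2}F(z,w)(\overline{z}-\overline{w})^k(1+\xi\overline{z})^{\mu-k}(1+\xi\overline{w})^{\nu-k}\,d\iota_\mu(z)\,d\iota_\nu(w).$$ $(a)_n=a(a+1)\cdots(a+n-1)$ denotes the rising Pochhammer symbol. *)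

(* Defs.v *)
(* MathComp-Analysis (Lebesgue integration) + real-closed complex numbers. *)
From HB Require Import structures.
From mathcomp Require Import all_boot all_order all_algebra.
From mathcomp Require Import all_classical all_reals all_analysis.
From mathcomp Require Import complex.
Set Implicit Arguments. Unset Strict Implicit. Unset Printing Implicit Defensive.
Import Order.TTheory GRing.Theory Num.Theory.
Local Open Scope ring_scope.
Local Open Scope complex_scope.

Section Defs.
Variable R : realType.

(* The complex plane C = R[i]; a point of R^2 (x,y) is identified with x + i y. *)
Definition toC (p : R * R) : R[i] := (p.1 +i* p.2).

(* Lebesgue measure on R (sigma-finite). *)
Notation leb := (@lebesgue_measure R : {sigma_finite_measure set (measurableTypeR R) -> \bar R}).
(* Lebesgue measure dA on C = R^2 (points (x, y)). *)
Notation lebC := ((leb \x leb)%E).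
(* Lebesgue measure dA(z) dA(w) on C^2 = R^4, points (((x1, y1), x2), y2)
   with z = x1 + i y1, w = x2 + i y2. *)
Notation lebC2 := ((((leb \x leb) \x leb) \x leb)%E).

(* squared modulus |z|^2 *)
Definition nrm2 (z : R[i]) : R := (complex.Re z) ^+ 2 + (complex.Im z) ^+ 2.

(* density of d iota_tau with respect to Lebesgue measure dA on C *)
Definition iota_dens (tau : nat) (z : R[i]) : R :=
  (tau.+1)%:R / ((1 + nrm2 z) ^+ tau) / (pi * (1 + nrm2 z) ^+ 2).


(* integral over C of a complex-valued f with respect to d iota_tau *)
Definition cint (tau : nat) (f : R[i] -> R[i]) : R[i] :=
  ((Rintegral lebC setT (fun p => complex.Re (f (toC p)) * iota_dens tau (toC p)))
   +i* (Rintegral lebC setT (fun p => complex.Im (f (toC p)) * iota_dens tau (toC p)))).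


(* integral over C^2 of f(z,w) with respect to d iota_mu(z) d iota_nu(w) *)
Definition c2int (mu nu : nat) (f : R[i] -> R[i] -> R[i]) : R[i] :=
  ((Rintegral lebC2 setT (fun p => complex.Re (f (toC p.1.1) (toC (p.1.2, p.2)))
                  * iota_dens mu (toC p.1.1) * iota_dens nu (toC (p.1.2, p.2))))
   +i* (Rintegral lebC2 setT (fun p => complex.Im (f (toC p.1.1) (toC (p.1.2, p.2)))
                  * iota_dens mu (toC p.1.1) * iota_dens nu (toC (p.1.2, p.2))))).

(* inner product of H_tau *)
Definition ipH (tau : nat) (f g : R[i] -> R[i]) : R[i] :=
  cint tau (fun z => f z * (g z)^*).

(* inner product of H_mu (x) H_nu *)
Definition ipT (mu nu : nat) (F G : R[i] -> R[i] -> R[i]) : R[i] :=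
  c2int mu nu (fun z w => F z w * (G z w)^*).

(* F lies in H_mu (x) H_nu : polynomial of degree <= mu in z and <= nu in w *)
Definition inTensor (mu nu : nat) (F : R[i] -> R[i] -> R[i]) : Prop :=
  exists a : 'M[R[i]]_(mu.+1, nu.+1),
    forall z w, F z w = \sum_(i < mu.+1) \sum_(j < nu.+1) a i j * z ^+ i * w ^+ j.

(* the map J_k *)
Definition Jk (mu nu k : nat) (F : R[i] -> R[i] -> R[i]) (xi : R[i]) : R[i] :=
  c2int mu nu (fun z w => F z w * (z^* - w^*) ^+ k
                 * (1 + xi * z^*) ^+ (mu - k) * (1 + xi * w^*) ^+ (nu - k)).

(* G = J_k^*(h) : G in H_mu (x) H_nu with <F, G> = <J_k F, h> for all F *)
Definition isJkAdj (mu nu k : nat) (h : R[i] -> R[i]) (G : R[i] -> R[i] -> R[i]) : Prop :=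
  inTensor mu nu G /\
  forall F, inTensor mu nu F -> ipT mu nu F G = ipH (mu + nu - 2 * k) (Jk mu nu k F) h.

(* rising Pochhammer symbol (a)_n *)
Definition rising (a : R[i]) (n : nat) : R[i] := \prod_(i < n) (a + i%:R).

End Defs.

(* Main.v *)
(**
  Write [iota_tau] for the probability measure of [H_tau].  Evaluating [J_k F] at
  the origin is pairing [F] with [(z - w)^k], and it is also pairing [J_k F] with
  the constant function [1], because [J_k F] is a polynomial and the positive
  powers of [xi] are orthogonal to [1].  Hence [J_k^*(1) = (z - w)^k] and the value
  sought is the squared norm of [(z - w)^k].  The monomials are orthogonal with
  [|z^j|^2 = 1 / 'C(tau, j)], so the binomial theorem leaves a sum which a
  Vandermonde-type convolution evaluates.

  The moments [I_s(a,b)] of [z^a zbar^b (1 + |z|^2)^-s] are found without polar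
  coordinates: integrating [d/dz] and [d/dzbar] of such functions to zero gives
  [(a+1) I_s(a,b) = s I_(s+1)(a+1,b+1) = (b+1) I_s(a,b)], hence orthogonality for
  [a <> b] and a recursion from [I_2(0,0) = pi] for [a = b].
*)
Require Import Defs.
From HB Require Import structures.
From mathcomp Require Import all_boot all_order all_algebra.
From mathcomp Require Import all_classical all_reals all_analysis.
From mathcomp Require Import measurable_realfun complex.
From mathcomp Require Import ring lra zify.
Set Implicit Arguments. Unset Strict Implicit. Unset Printing Implicit Defensive.
Import Order.TTheory GRing.Theory Num.Theory.
Import numFieldNormedType.Exports.
Local Open Scope classical_set_scope.
Local Open Scope ring_scope.
Local Open Scope complex_scope.

(* Conjugation is [Num.conj], as in the arithmetic subterms of the definitions;
   [z^*] outside of an arithmetic operation would parse as [conjc], which is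
   convertible to it but not found by rewriting.  Hence the [%R] annotations. *)

(** * Integrals on the line *)

Section LineIntegrals.
Context {R : realType}.
Notation leb := (@lebesgue_measure R).
Implicit Types (f F : R -> R).

Lemma is_derive_continuous F f : (forall x : R, is_derive x 1 F (f x)) -> continuous F.
Proof.
move=> dF x; apply: differentiable_continuous; apply/derivable1_diffP.
by have [] := dF x.
Qed.

(** Evenness doubles the integral over the half-line, where the fundamental theorem gives the limit
    of [F] minus [F 0]. *)
Lemma ge0_even_integralT_FTC f F (l : R) :
  (forall x, 0 <= f x) -> continuous f -> f =1 f \o -%R ->
  (forall x : R, is_derive x 1 F (f x)) -> F 0 = 0 -> F x @[x --> +oo] --> l ->
  (\int[leb]_x (f x)%:E = (2 * l)%:E)%E.
Proof.
move=> f0 cf ef dF F0 Fl; rewrite ge0_symfun_integralT//.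
have -> : [set x : R | 0 <= x] = [set` `[0, +oo[] by rewrite set_itvcy.
rewrite (@ge0_continuous_FTC2y _ f F 0 l)//.
- by rewrite F0 sube0 EFinM.
- exact: continuous_subspaceT.
- apply: cvg_at_right_filter; exact: (is_derive_continuous dF).
- by move=> x _; rewrite derive1E; have [_ ->] := dF x.
Qed.

(** Dominated convergence, with dominating function [|f|], makes the integral the limit of integrals
    over growing symmetric intervals; on each the fundamental theorem gives a difference of two
    values of [F], both tending to 0. *)
Lemma integralT_deriv_eq0 f F :
  leb.-integrable [set: R] (EFin \o f) -> continuous f ->
  (forall x : R, is_derive x 1 F (f x)) ->
  F x @[x --> +oo] --> (0:R) -> F x @[x --> -oo] --> (0:R) ->
  (\int[leb]_x (f x)%:E = 0)%E.
Proof.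
move=> intf cf dF Fy FNy.
(* The shift to [n.+1] keeps the interval nondegenerate at [n = 0], as the fundamental theorem
   requires. *)
pose I n : set (measurableTypeR R) := [set` `[- n.+1%:R, n.+1%:R]].
pose fn n : R -> \bar R := (EFin \o f) \_ (I n).
have /integrableP[mf _] := intf.
have fnE n : (\int[leb]_x fn n x = (F n.+1%:R)%:E - (F (- n.+1%:R))%:E)%E.
  rewrite /fn -integral_mkcond; apply: continuous_FTC2.
  - by rewrite gtrN ?ltr0n.
  - exact: continuous_subspaceT.
  - split.
    + by move=> x _; have [] := dF x.
    + apply: cvg_at_right_filter; exact: (is_derive_continuous dF).
    + apply: cvg_at_left_filter; exact: (is_derive_continuous dF).
  - by move=> x _; rewrite derive1E; have [_ ->] := dF x.
have nS : (n.+1%:R : R) @[n --> \oo] --> +oo.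
  by have := @cvgr_idn R; rewrite -(cvg_shiftS (fun n : nat => n%:R : R)).
have l1 : (\int[leb]_x fn n x)%E @[n --> \oo] --> (0%:E : \bar R).
  rewrite (_ : (fun n => _) = fun n => (F n.+1%:R - F (- n.+1%:R))%:E); last first.
    by apply/funext => n; rewrite fnE.
  apply: cvg_EFin; first exact: nearW.
  rewrite -[X in _ --> X](subr0 (0:R)); apply: cvgB.
  - exact: (cvg_comp _ _ nS Fy).
  - apply: (cvg_comp _ _ _ FNy).
    by apply/cvgNry; rewrite opprK; exact: nS.
apply: (cvg_unique _ _ l1) => //.
apply: (@dominated_cvg _ _ _ leb [set: R] measurableT fn _ (abse \o (EFin \o f))) => //.
- move=> n; have mI : measurable (I n) by exact: (@measurable_itv R).
  apply: (measurable_int leb); apply/(integrable_mkcond (mu := leb) (EFin \o f) mI).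
  by apply: integrableS intf.
- move=> x _; apply: cvg_near_cst.
  near=> n; rewrite /fn patchE mem_set//= /I /= in_itv/=.
  rewrite -ler_norml; near: n.
  move: nS => /cvgryPge; exact.
- exact: integrable_abse.
- move=> n x _; rewrite /fn patchE; case: ifP => //= _.
  by rewrite normr0 lee_fin.
Unshelve. all: by end_near. Qed.

(** * Two explicit integrals over the line *)

(** The primitive comes from the usual reduction of (c^2 + y^2)^-2 to (c^2 + y^2)^-1. Later c =
    sqrt(1 + x^2), so that c^2 + y^2 = 1 + |z|^2. *)
Lemma is_derive_rational_atan (c : R) : 0 < c -> forall y : R,
  is_derive y 1 (fun y => y / (2 * c ^+ 2 * (c ^+ 2 + y ^+ 2))
    + atan (y / c) / (2 * c ^+ 3)) ((c ^+ 2 + y ^+ 2) ^- 2).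
Proof.
move=> c0 y.
have h0 : c ^+ 2 + y ^+ 2 != 0 by rewrite gt_eqF// ltr_wpDr ?sqr_ge0 ?exprn_gt0.
have h1 : 2 * c ^+ 2 * (c ^+ 2 + y ^+ 2) != 0.
  by rewrite !mulf_neq0// ?expf_neq0 ?gt_eqF.
apply: is_derive_eq.
rewrite /GRing.scale/=.
by field; rewrite h0 gt_eqF.
Qed.

Lemma continuous_sqrDV (c : R) : 0 < c -> continuous (fun y : R => (c ^+ 2 + y ^+ 2) ^- 2).
Proof.
move=> c0 y.
apply: cvgV.
  by rewrite expf_neq0// gt_eqF// ltr_wpDr ?sqr_ge0 ?exprn_gt0.
apply: (@continuous_comp _ _ _ (fun y : R => c ^+ 2 + y ^+ 2) (@GRing.exp R ^~ 2)); last exact: exprn_continuous.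
by apply: cvgD; [exact: cvg_cst|exact: exprn_continuous].
Qed.

(** The hypothesis says that [F] is O(1/x); decay at infinity is checked below in this form. *)
Lemma cvgy0_norm_mul_le F (C : R) : (forall x, 0 < x -> `|F x| * x <= C) ->
  F x @[x --> +oo] --> (0 : R).
Proof.
move=> h; apply/cvgr0Pnorm_le => e e0.
near=> x.
have x0 : 0 < x by near: x; exact: nbhs_pinfty_gt.
rewrite -(ler_pM2r x0) (le_trans (h _ x0))// mulrC -ler_pdivrMr//.
Unshelve. all: by end_near. Qed.

Lemma cvg_rational_atan (c : R) : 0 < c ->
  y / (2 * c ^+ 2 * (c ^+ 2 + y ^+ 2)) + atan (y / c) / (2 * c ^+ 3) @[y --> +oo]
     --> pi / (4 * c ^+ 3).
Proof.
move=> c0.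
rewrite (_ : pi / (4 * c ^+ 3) = 0 + pi / 2 / (2 * c ^+ 3)); last first.
  by field; rewrite gt_eqF.
apply: cvgD.
- apply: (@cvgy0_norm_mul_le _ ((2 * c ^+ 2)^-1)) => x x0.
  rewrite ger0_norm; last first.
    rewrite divr_ge0 ?(ltW x0)//; apply: mulr_ge0; last by rewrite addr_ge0 ?sqr_ge0.
    by rewrite mulr_ge0 ?sqr_ge0.
  have h0 : 0 < c ^+ 2 + x ^+ 2 by rewrite ltr_wpDr ?sqr_ge0 ?exprn_gt0.
  have -> : x / (2 * c ^+ 2 * (c ^+ 2 + x ^+ 2)) * x =
     (2 * c ^+ 2)^-1 * (x ^+ 2 / (c ^+ 2 + x ^+ 2)).
    by field; rewrite !gt_eqF.
  rewrite ler_piMr ?invr_ge0 ?mulr_ge0 ?sqr_ge0 ?(ltW c0)//.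
  by rewrite ler_pdivrMr// mul1r lerDr sqr_ge0.
- apply: cvgMr_tmp.
  apply: (@cvg_comp _ _ _ (fun x : R => x / c) atan _ +oo); last exact: cvgy_atan.
  apply/cvgryPge => A; near=> x; rewrite ler_pdivlMr//.
Unshelve. all: by end_near. Qed.

Lemma integral_sqrDV (c : R) : 0 < c ->
  (\int[leb]_y ((c ^+ 2 + y ^+ 2) ^- 2)%:E = (pi / (2 * c ^+ 3))%:E)%E.
Proof.
move=> c0.
rewrite (ge0_even_integralT_FTC _ _ _ (is_derive_rational_atan c0) _ (cvg_rational_atan c0)).
- by congr EFin; field; rewrite gt_eqF.
- by move=> x; rewrite invr_ge0 exprn_ge0// addr_ge0// sqr_ge0.
- exact: continuous_sqrDV.
- by move=> x /=; rewrite sqrrN.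
- by rewrite !mul0r atan0 mul0r addr0.
Qed.

(** The derivative is the value of [integral_sqrDV] at c = sqrt(1 + x^2), so this primitive serves
    for the outer of the two iterated integrals. *)
Lemma is_derive_sqrt_ratio (x : R) :
  is_derive x 1 (fun x => pi / 2 * (x / Num.sqrt (1 + x ^+ 2)))
   (pi / (2 * Num.sqrt (1 + x ^+ 2) ^+ 3)).
Proof.
have h0 : 0 < 1 + x ^+ 2 by rewrite ltr_pwDl// sqr_ge0.
have h1 : Num.sqrt (1 + x ^+ 2) != 0 by rewrite gt_eqF// sqrtr_gt0.
have h2 : Num.sqrt (1 + x ^+ 2) ^+ 2 = 1 + x ^+ 2 by rewrite sqr_sqrtr// ltW.
have ? : is_derive x 1 (fun x => Num.sqrt (1 + x ^+ 2)) (x / Num.sqrt (1 + x ^+ 2)).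
  have ? := is_derive1_sqrt h0.
  apply: is_derive_eq.
  rewrite /GRing.scale/=.
  by field.
apply: is_derive_eq.
rewrite /GRing.scale/=.
move: h1 h2; set s := Num.sqrt _ => h1 h2.
have -> : - s ^- 2 * (x / s) = - x / s ^+ 3 by field.
apply: (mulIf (expf_neq0 3 h1)); apply/eqP; rewrite -subr_eq0.
have -> : pi / 2 * (x * (- x / s ^+ 3) + s^-1 * 1) * s ^+ 3 - pi / (2 * s ^+ 3) * s ^+ 3
  = pi / 2 * (s ^+ 2 - (1 + x ^+ 2)) by field.
by rewrite h2 subrr mulr0.
Qed.

Lemma cvg_sqrt_ratio :
  pi / 2 * (x / Num.sqrt (1 + x ^+ 2)) @[x --> +oo] --> (pi / 2 : R).
Proof.
rewrite -[X in _ --> X](mulr1 (pi / 2)); apply: cvgMl_tmp.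
apply/subr_cvg0; apply: (@cvgy0_norm_mul_le _ 1) => x x0.
set s := Num.sqrt _.
have h0 : 0 < 1 + x ^+ 2 by rewrite ltr_pwDl// sqr_ge0.
have s2 : s ^+ 2 = 1 + x ^+ 2 by rewrite sqr_sqrtr// ltW.
have sx : x <= s by rewrite -(ler_pXn2r (n := 2))// ?nnegrE ?sqrtr_ge0 ?ltW// s2; lra.
have s0 : 0 < s by rewrite sqrtr_gt0.
have s1 : 1 <= s by nra.
have -> : x / s - 1 = - ((s - x) / s) by field; rewrite gt_eqF.
rewrite normrN ger0_norm; last by rewrite divr_ge0 ?subr_ge0// ltW.
(* Since s^2 - x^2 = 1, one has (s - x) x <= (s - x)(s + x) = 1 <= s. *)
rewrite mulrAC ler_pdivrMr// mul1r; nra.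
Qed.

Lemma continuous_sqrt_ratio : continuous (fun x : R => pi / (2 * Num.sqrt (1 + x ^+ 2) ^+ 3)).
Proof.
move=> x; apply: cvgMl_tmp; apply: cvgV.
  by rewrite mulf_neq0// expf_neq0// gt_eqF// sqrtr_gt0 ltr_pwDl// sqr_ge0.
apply: cvgMl_tmp.
apply: (@continuous_comp _ _ _ (fun y : R => Num.sqrt (1 + y ^+ 2)) (@GRing.exp R ^~ 3)); last exact: exprn_continuous.
apply: (@continuous_comp _ _ _ (fun x : R => 1 + x ^+ 2) Num.sqrt); last exact: sqrt_continuous.
by apply: cvgD; [exact: cvg_cst|exact: exprn_continuous].
Qed.

Lemma integral_sqrt_ratio :
  (\int[leb]_x (pi / (2 * Num.sqrt (1 + x ^+ 2) ^+ 3))%:E = pi%:E :> \bar R)%E.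
Proof.
rewrite (ge0_even_integralT_FTC _ _ _ is_derive_sqrt_ratio _ cvg_sqrt_ratio).
- by congr EFin; field.
- by move=> x; rewrite divr_ge0 ?pi_ge0// mulr_ge0 ?exprn_ge0// sqrtr_ge0.
- exact: continuous_sqrt_ratio.
- by move=> x /=; rewrite sqrrN.
- by rewrite !mul0r mulr0.
Qed.

End LineIntegrals.

(** * Complex-valued integrals *)

Section ComplexParts.
Context {R : realType}.
Implicit Types (a b z : R[i]).

Lemma Re_mul a b : complex.Re (a * b) = complex.Re a * complex.Re b - complex.Im a * complex.Im b.
Proof. by case: a b => [? ?] [? ?]. Qed.

Lemma Im_mul a b : complex.Im (a * b) = complex.Re a * complex.Im b + complex.Im a * complex.Re b.
Proof. by case: a b => [? ?] [? ?]. Qed.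

Lemma Re_add a b : complex.Re (a + b) = complex.Re a + complex.Re b.
Proof. by case: a b => [? ?] [? ?]. Qed.

Lemma Im_add a b : complex.Im (a + b) = complex.Im a + complex.Im b.
Proof. by case: a b => [? ?] [? ?]. Qed.

Lemma nrm2M a b : nrm2 (a * b) = nrm2 a * nrm2 b.
Proof. by rewrite /nrm2 Re_mul Im_mul; ring. Qed.

Lemma nrm2X a n : nrm2 (a ^+ n) = nrm2 a ^+ n.
Proof.
elim: n => [|n IH]; first by rewrite !expr0 /nrm2 /= expr1n expr0n addr0.
by rewrite !exprS nrm2M IH.
Qed.

Lemma nrm2_conj a : nrm2 (a^*)%R = nrm2 a.
Proof. by case: a => x y; rewrite /nrm2/= sqrrN. Qed.

Lemma nrm2_real (r : R) : nrm2 r%:C = r ^+ 2.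
Proof. by rewrite /nrm2/= expr0n addr0. Qed.

Lemma nrm2_ge0 a : 0 <= nrm2 a.
Proof. by rewrite addr_ge0 ?sqr_ge0. Qed.

Lemma nrm2E a : (nrm2 a)%:C = a * (a^*)%R.
Proof. by case: a => x y; rewrite /nrm2; simpc; congr (_ +i* _); ring. Qed.

Lemma norm_Re_le a (r : R) : 0 <= r -> nrm2 a <= r ^+ 2 -> `|complex.Re a| <= r.
Proof.
move=> r0 h; rewrite -(ler_pXn2r (n := 2))// ?nnegrE// real_normK ?num_real//.
by rewrite (le_trans _ h)// lerDl sqr_ge0.
Qed.

Lemma norm_Im_le a (r : R) : 0 <= r -> nrm2 a <= r ^+ 2 -> `|complex.Im a| <= r.
Proof.
move=> r0 h; rewrite -(ler_pXn2r (n := 2))// ?nnegrE// real_normK ?num_real//.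
by rewrite (le_trans _ h)// lerDr sqr_ge0.
Qed.
End ComplexParts.

Section ComplexIntegral.
Context (d : measure_display) (T : measurableType d) (R : realType).
Variable m : {measure set T -> \bar R}.
Implicit Types (f g : T -> R[i]) (c : R[i]).

Definition Cmeasurable f :=
  measurable_fun setT (fun x => complex.Re (f x)) /\
  measurable_fun setT (fun x => complex.Im (f x)).

Definition Cintegrable f :=
  m.-integrable setT (EFin \o (fun x => complex.Re (f x))) /\
  m.-integrable setT (EFin \o (fun x => complex.Im (f x))).

(** Taken by parts, as [cint] and [c2int] are, so that both become instances once the density is
    moved into the integrand. *)
Definition Cintegral f : R[i] :=
  (\int[m]_x complex.Re (f x))%R +i* (\int[m]_x complex.Im (f x))%R.

Lemma CmeasurableM f g : Cmeasurable f -> Cmeasurable g ->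
  Cmeasurable (fun x => f x * g x).
Proof.
move=> [f1 f2] [g1 g2]; split.
- under eq_fun do rewrite Re_mul.
  by apply: measurable_funB; apply: measurable_funM.
- under eq_fun do rewrite Im_mul.
  by apply: measurable_funD; apply: measurable_funM.
Qed.

Lemma Cmeasurable_cst c : Cmeasurable (fun=> c).
Proof. by split; exact: measurable_cst. Qed.

Lemma CmeasurableX f n : Cmeasurable f -> Cmeasurable (fun x => f x ^+ n).
Proof.
move=> mf; elim: n => [|n IH]; first exact: Cmeasurable_cst.
by under eq_fun do rewrite exprS; exact: CmeasurableM.
Qed.

Lemma Cmeasurable_conj f : Cmeasurable f -> Cmeasurable (fun x => ((f x)^*)%R).
Proof.
move=> [f1 f2]; split.
- by rewrite (_ : (fun x => _) = fun x => complex.Re (f x))//; apply/funext => x; case: (f x).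
- rewrite (_ : (fun x => _) = fun x => - complex.Im (f x)); last by apply/funext => x; case: (f x).
  exact: measurableT_comp.
Qed.

Lemma Cmeasurable_real (h : T -> R) : measurable_fun setT h -> Cmeasurable (fun x => (h x)%:C).
Proof. by move=> mh; split => //=; exact: measurable_cst. Qed.

(** Domination is expressed with the squared modulus, which is multiplicative, free of square roots,
    and bounds both parts at once. *)
Lemma le_Cintegrable f (h : T -> R) : Cmeasurable f ->
  m.-integrable setT (EFin \o h) -> (forall x, 0 <= h x) ->
  (forall x, nrm2 (f x) <= h x ^+ 2) -> Cintegrable f.
Proof.
move=> [f1 f2] ih h0 fh; split.
- apply: le_integrable ih => //; first exact/measurable_EFinP.
  by move=> x _ /=; rewrite lee_fin [leRHS]ger0_norm//; exact: norm_Re_le.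
- apply: le_integrable ih => //; first exact/measurable_EFinP.
  by move=> x _ /=; rewrite lee_fin [leRHS]ger0_norm//; exact: norm_Im_le.
Qed.

Lemma RintegrableD (f g : T -> R) : m.-integrable setT (EFin \o f) ->
  m.-integrable setT (EFin \o g) -> m.-integrable setT (EFin \o (fun x => f x + g x)).
Proof. by move=> hf hg; apply: eq_integrable (integrableD _ hf hg). Qed.

Lemma RintegrableB (f g : T -> R) : m.-integrable setT (EFin \o f) ->
  m.-integrable setT (EFin \o g) -> m.-integrable setT (EFin \o (fun x => f x - g x)).
Proof. by move=> hf hg; apply: eq_integrable (integrableB _ hf hg). Qed.

Lemma RintegrableZ (r : R) (f : T -> R) : m.-integrable setT (EFin \o f) ->
  m.-integrable setT (EFin \o (fun x => r * f x)).
Proof. by move=> hf; apply: eq_integrable (integrableZl _ r hf). Qed.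

Lemma Cintegrable0 : Cintegrable (fun=> 0).
Proof. by split; apply: eq_integrable (integrable0 _ _). Qed.

Lemma CintegrableD f g : Cintegrable f -> Cintegrable g ->
  Cintegrable (fun x => f x + g x).
Proof.
move=> [f1 f2] [g1 g2]; split.
- by under eq_fun do rewrite Re_add; exact: RintegrableD.
- by under eq_fun do rewrite Im_add; exact: RintegrableD.
Qed.

Lemma CintegrableZ c f : Cintegrable f -> Cintegrable (fun x => c * f x).
Proof.
move=> [f1 f2]; split.
- by under eq_fun do rewrite Re_mul; apply: RintegrableB; exact: RintegrableZ.
- by under eq_fun do rewrite Im_mul; apply: RintegrableD; exact: RintegrableZ.
Qed.

Lemma eq_Cintegrable f g : f =1 g -> Cintegrable f -> Cintegrable g.
Proof. by move=> /funext ->. Qed.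

Lemma Cintegrable_sum I (s : seq I) (P : pred I) (F : I -> T -> R[i]) :
  (forall i, P i -> Cintegrable (F i)) ->
  Cintegrable (fun x => \sum_(i <- s | P i) F i x).
Proof.
move=> h; elim: s => [|i s IH].
  by under eq_fun do rewrite big_nil; exact: Cintegrable0.
under eq_fun do rewrite big_cons.
by case: (boolP (P i)) => // Pi; apply: CintegrableD => //; exact: h.
Qed.

Lemma eq_Cintegral f g : f =1 g -> Cintegral f = Cintegral g.
Proof. by move=> /funext ->. Qed.

Lemma Cintegral0 : Cintegral (fun=> 0) = 0.
Proof. by rewrite /Cintegral /Rintegral/= integral0. Qed.

Lemma CintegralD f g : Cintegrable f -> Cintegrable g ->
  Cintegral (fun x => f x + g x) = Cintegral f + Cintegral g.
Proof.
move=> [f1 f2] [g1 g2]; rewrite /Cintegral.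
under eq_Rintegral do rewrite Re_add.
rewrite RintegralD//.
under [X in _ +i* X]eq_Rintegral do rewrite Im_add.
by rewrite RintegralD.
Qed.

Lemma CintegralZ c f : Cintegrable f ->
  Cintegral (fun x => c * f x) = c * Cintegral f.
Proof.
move=> [f1 f2]; rewrite /Cintegral.
under eq_Rintegral do rewrite Re_mul.
rewrite RintegralB ?RintegralZl//; try exact: RintegrableZ.
under [X in _ +i* X]eq_Rintegral do rewrite Im_mul.
rewrite RintegralD ?RintegralZl//; try exact: RintegrableZ.
by case: c.
Qed.

Lemma Cintegral_sum I (s : seq I) (P : pred I) (F : I -> T -> R[i]) :
  (forall i, P i -> Cintegrable (F i)) ->
  Cintegral (fun x => \sum_(i <- s | P i) F i x) = \sum_(i <- s | P i) Cintegral (F i).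
Proof.
move=> h; elim: s => [|i s IH].
  by under eq_Cintegral do rewrite big_nil; rewrite big_nil Cintegral0.
under eq_Cintegral do rewrite big_cons.
rewrite big_cons; case: (boolP (P i)) => // Pi.
by rewrite CintegralD ?IH//; [exact: h|exact: Cintegrable_sum].
Qed.

Lemma Cintegral_conj f : Cintegrable f ->
  Cintegral (fun x => ((f x)^*)%R) = ((Cintegral f)^*)%R.
Proof.
move=> [f1 f2]; rewrite /Cintegral/=; congr (_ +i* _).
  by apply: eq_Rintegral => x _; case: (f x).
rewrite -mulN1r -RintegralZl//; apply: eq_Rintegral => x _; case: (f x) => a b /=.
by rewrite mulN1r.
Qed.
End ComplexIntegral.

(** * Moments on the plane *)

Section Plane.
Context {R : realType}.
Notation leb := (@lebesgue_measure R : {sigma_finite_measure set (measurableTypeR R) -> \bar R}).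
Notation lebC := ((leb \x leb)%E).
Notation RR := (measurableTypeR R * measurableTypeR R)%type.

(** * The weight 1 + |z|^2 *)

Definition rho (p : R * R) : R := 1 + nrm2 (toC p).

Lemma rhoE x y : rho (x, y) = 1 + (x ^+ 2 + y ^+ 2).
Proof. by []. Qed.

Lemma rho_ge1 p : 1 <= rho p.
Proof. by rewrite lerDl nrm2_ge0. Qed.

Lemma rho_gt0 p : 0 < rho p.
Proof. exact: lt_le_trans ltr01 (rho_ge1 p). Qed.

Lemma rho_swap x y : rho (x, y) = rho (y, x).
Proof. by rewrite !rhoE; ring. Qed.

Lemma measurable_rho : measurable_fun [set: RR] rho.
Proof.
apply: measurable_funD; first exact: measurable_cst.
by apply: measurable_funD; apply: measurable_funX; [exact: measurable_fst|exact: measurable_snd].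
Qed.

Lemma measurable_rhoV n : measurable_fun [set: RR] (fun p => rho p ^- n).
Proof.
under eq_fun do rewrite -exprVn.
apply: measurable_funX.
have cV : {in [set r : R | 0 < r], continuous (@GRing.inv R)}.
  by move=> r; rewrite inE => r0; apply: inv_continuous; rewrite gt_eqF.
apply: (measurable_comp (F := [set r : R | 0 < r])) => //.
- by apply: open_measurable; exact: open_gt.
- by move=> _ [p _ <-] /=; exact: rho_gt0.
- by apply: open_continuous_measurable_fun => //; exact: open_gt.
- exact: measurable_rho.
Qed.

Lemma integral_rho_line (x : R) :
  (\int[leb]_y ((rho (x, y)) ^- 2)%:E = (pi / (2 * Num.sqrt (1 + x ^+ 2) ^+ 3))%:E)%E.
Proof.
have x0 : 0 < 1 + x ^+ 2 by rewrite ltr_pwDl// sqr_ge0.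
rewrite -integral_sqrDV ?sqrtr_gt0//.
by apply: eq_integral => y _; rewrite sqr_sqrtr ?ltW// rhoE addrA.
Qed.

(** Tonelli reduces this to the two line integrals above. It is the base value I_2(0,0), and it
    makes [rho ^- 2] the dominating function for every integrability claim on the plane. *)
Lemma integral_rho2 : (\int[lebC]_p ((rho p) ^- 2)%:E = pi%:E)%E.
Proof.
rewrite fubini_tonelli1//=.
- rewrite /fubini_F; under eq_integral do rewrite integral_rho_line.
  exact: integral_sqrt_ratio.
- by apply/measurable_EFinP; exact: measurable_rhoV.
- by move=> p; rewrite lee_fin invr_ge0 exprn_ge0// ltW// rho_gt0.
Qed.

Lemma integrable_rho2 : lebC.-integrable setT (EFin \o (fun p => (rho p) ^- 2)).
Proof.
apply/integrableP; split; first by apply/measurable_EFinP; exact: measurable_rhoV.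
under eq_integral => p _.
  rewrite gee0_abs; last by rewrite lee_fin invr_ge0 exprn_ge0// ltW// rho_gt0.
  over.
by rewrite integral_rho2 ltry.
Qed.

Lemma integrable_rho_line (x : R) :
  leb.-integrable setT (EFin \o (fun y => (rho (x, y)) ^- 2)).
Proof.
apply/integrableP; split.
  apply/measurable_EFinP.
  exact: (measurableT_comp (measurable_rhoV 2) (pair1_measurable x)).
under eq_integral => p _.
  rewrite gee0_abs; last by rewrite lee_fin invr_ge0 exprn_ge0// ltW// rho_gt0.
  over.
by rewrite integral_rho_line ltry.
Qed.

(** * Weighted monomials, the integrands of the moments I_s(a,b) *)

Definition wmon (s a b : nat) (p : R * R) : R[i] :=
  toC p ^+ a * ((toC p)^*)%R ^+ b * (rho p ^- s)%:C.

Lemma Cmeasurable_wmon s a b : Cmeasurable (T := RR) (wmon s a b).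
Proof.
have h : Cmeasurable (T := RR) (@toC R).
  by split => /=; [exact: measurable_fst|exact: measurable_snd].
have hr := Cmeasurable_real (T := RR) (measurable_rhoV s).
rewrite /wmon; apply: CmeasurableM => //.
by apply: CmeasurableM; apply: CmeasurableX => //; exact: Cmeasurable_conj.
Qed.

(** From |z|^2 <= rho the squared modulus is at most rho^(a+b-2s), and rho >= 1 allows the exponent
    to be raised to -n. The case n = 4 gives domination by rho^-2, hence integrability; n = 2 gives
    the decay of boundary terms. *)
Lemma nrm2_wmon_le s a b n p : (a + b + n <= 2 * s)%N ->
  nrm2 (wmon s a b p) <= rho p ^- n.
Proof.
move=> h; rewrite /wmon !nrm2M !nrm2X nrm2_conj nrm2_real -exprD.
have r0 := rho_gt0 p; have r1 := rho_ge1 p.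
have hle : nrm2 (toC p) ^+ (a + b) <= rho p ^+ (a + b).
  by rewrite lerXn2r ?nnegrE ?nrm2_ge0 ?(ltW r0)// /rho lerDr.
rewrite exprVn -exprM ler_pdivrMr ?exprn_gt0//.
apply: (le_trans hle).
rewrite ler_pdivlMl ?exprn_gt0// -exprD ler_weXn2l//.
by rewrite addnC mulnC.
Qed.

Lemma Cintegrable_wmon s a b : (a + b + 4 <= 2 * s)%N -> Cintegrable lebC (wmon s a b).
Proof.
move=> h; apply: le_Cintegrable integrable_rho2 _ _.
- exact: Cmeasurable_wmon.
- by move=> p; rewrite invr_ge0 exprn_ge0// ltW// rho_gt0.
- by move=> p; rewrite exprVn -exprM; exact: nrm2_wmon_le.
Qed.

Lemma Cintegrable_wmon_line1 s a b (x : R) : (a + b + 4 <= 2 * s)%N ->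
  Cintegrable leb (fun y => wmon s a b (x, y)).
Proof.
move=> h; apply: le_Cintegrable (integrable_rho_line x) _ _.
- have [m1 m2] := Cmeasurable_wmon s a b.
  split; [exact: (measurableT_comp m1 (pair1_measurable x))|].
  exact: (measurableT_comp m2 (pair1_measurable x)).
- by move=> p; rewrite invr_ge0 exprn_ge0// ltW// rho_gt0.
- by move=> p; rewrite exprVn -exprM; exact: nrm2_wmon_le.
Qed.

Lemma Cintegrable_wmon_line2 s a b (y : R) : (a + b + 4 <= 2 * s)%N ->
  Cintegrable leb (fun x => wmon s a b (x, y)).
Proof.
move=> h; apply: le_Cintegrable (integrable_rho_line y) _ _.
- have [m1 m2] := Cmeasurable_wmon s a b.
  split; [exact: (measurableT_comp m1 (pair2_measurable y))|].
  exact: (measurableT_comp m2 (pair2_measurable y)).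
- by move=> p; rewrite invr_ge0 exprn_ge0// ltW// rho_gt0.
- by move=> p; rewrite exprVn -exprM rho_swap; exact: nrm2_wmon_le.
Qed.

(** * Derivatives along the real coordinates *)

Definition is_Cderive (f : R -> R[i]) (t : R) (df : R[i]) :=
  is_derive t 1 (fun t => complex.Re (f t)) (complex.Re df) /\
  is_derive t 1 (fun t => complex.Im (f t)) (complex.Im df).

Lemma is_Cderive_eq f t df df' : is_Cderive f t df -> df = df' -> is_Cderive f t df'.
Proof. by move=> h <-. Qed.

Lemma is_CderiveM f g t df dg : is_Cderive f t df -> is_Cderive g t dg ->
  is_Cderive (fun t => f t * g t) t (df * g t + f t * dg).
Proof.
move=> [f1 f2] [g1 g2]; split.
- under eq_fun do rewrite Re_mul.
  by apply: is_derive_eq; rewrite /GRing.scale/= Re_add !Re_mul; ring.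
- under eq_fun do rewrite Im_mul.
  by apply: is_derive_eq; rewrite /GRing.scale/= Im_add !Im_mul; ring.
Qed.

Lemma is_CderiveX f t df n : is_Cderive f t df ->
  is_Cderive (fun t => f t ^+ n) t (n%:R * f t ^+ n.-1 * df).
Proof.
move=> hf; elim: n => [|n IH].
  rewrite !mul0r; split => /=; exact: is_derive_cst.
under eq_fun do rewrite exprS.
apply: (is_Cderive_eq (is_CderiveM hf IH)).
case: n {IH} => [|n]; first by rewrite !expr0; ring.
by rewrite /= exprS -!natr1; ring.
Qed.

Lemma is_Cderive_conj f t df : is_Cderive f t df -> is_Cderive (fun t => ((f t)^*)%R) t (df^*)%R.
Proof.
move=> [f1 f2]; split.
- rewrite (_ : (fun t => _) = fun x => complex.Re (f x)); last by apply/funext => x; case: (f x).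
  by case: df f1 f2.
- rewrite (_ : (fun t => _) = fun x => - complex.Im (f x)); last by apply/funext => x; case: (f x).
  by apply: is_derive_eq; case: df f1 f2.
Qed.

Lemma is_Cderive_real (h : R -> R) (t dh : R) : is_derive t 1 h dh ->
  is_Cderive (fun t => (h t)%:C) t dh%:C.
Proof. by move=> hh; split => //=; exact: is_derive_cst. Qed.

Lemma is_derive_rhoV1 s (x y : R) :
  is_derive x 1 (fun x => rho (x, y) ^- s) (- (s%:R * 2 * x * rho (x, y) ^- s.+1)).
Proof.
have r0 : rho (x, y) != 0 by rewrite gt_eqF// rho_gt0.
have h : is_derive x 1 (fun x => rho (x, y)) (2 * x).
  rewrite (_ : (fun x => _) = fun x => 1 + (x ^+ 2 + y ^+ 2))//.
  by apply: is_derive_eq; rewrite /GRing.scale/=; ring.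
have h' : rho (x, y) ^+ s != 0 by rewrite expf_neq0.
have h1 : is_derive x 1 (fun x0 : R => rho (x0, y) ^+ s) (s%:R * rho (x, y) ^+ s.-1 * (2 * x)).
  by have := is_deriveX s h; rewrite exprfctE.
have h2 := @is_deriveV R (fun x0 => rho (x0, y) ^+ s) _ _ _ h' h1.
suff <- : - (rho (x, y) ^+ s) ^- 2 *: (s%:R * rho (x, y) ^+ s.-1 * (2 * x)) =
  - (s%:R * 2 * x * rho (x, y) ^- s.+1) by exact: h2.
rewrite /GRing.scale/= {h1 h2}.
case: s h' => [|s] h' /=; first by rewrite !mul0r; ring.
by rewrite !exprS; field; rewrite r0 expf_neq0.
Qed.

Lemma is_Cderive_wmon1 s a b (x y : R) :
  is_Cderive (fun x => wmon s a b (x, y)) x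
    (a%:R * wmon s a.-1 b (x, y) + b%:R * wmon s a b.-1 (x, y)
     + (- s%:R) * (wmon s.+1 a.+1 b (x, y) + wmon s.+1 a b.+1 (x, y))).
Proof.
have hz : is_Cderive (fun x => toC (x, y)) x 1.
  by split => /=; [exact: is_derive_id|exact: is_derive_cst].
have hr := is_Cderive_real (is_derive_rhoV1 s x y).
apply: (is_Cderive_eq (is_CderiveM (is_CderiveM (is_CderiveX a hz) (is_CderiveX b (is_Cderive_conj hz))) hr)).
rewrite /wmon rmorph1.
have -> : (- (s%:R * 2 * x * rho (x, y) ^- s.+1))%:C =
  - s%:R * (toC (x, y) + ((toC (x, y))^*)%R) * (rho (x, y) ^- s.+1)%:C.
  rewrite rmorphN !rmorphM/= !rmorph_nat.
  have -> : toC (x, y) + ((toC (x, y))^*)%R = 2 * x%:C.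
    exact: (addcJ (toC (x, y))).
  ring.
rewrite !exprS; ring.
Qed.

Lemma is_Cderive_wmon2 s a b (x y : R) :
  is_Cderive (fun y => wmon s a b (x, y)) y
    ('i%C * a%:R * wmon s a.-1 b (x, y) + (- 'i%C * b%:R) * wmon s a b.-1 (x, y)
     + ('i%C * s%:R) * (wmon s.+1 a.+1 b (x, y) + (-1) * wmon s.+1 a b.+1 (x, y))).
Proof.
have hz : is_Cderive (fun y => toC (x, y)) y 'i%C.
  by split => /=; [exact: is_derive_cst|exact: is_derive_id].
(* The weight is symmetric in x and y, so its y-derivative is read off from the x-derivative. *)
have hr0 : is_derive y 1 (fun y => rho (x, y) ^- s) (- (s%:R * 2 * y * rho (x, y) ^- s.+1)).
  have := is_derive_rhoV1 s y x; rewrite rho_swap.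
  by under eq_fun do rewrite rho_swap.
have hr := is_Cderive_real hr0.
apply: (is_Cderive_eq (is_CderiveM (is_CderiveM (is_CderiveX a hz) (is_CderiveX b (is_Cderive_conj hz))) hr)).
rewrite /wmon.
have -> : (('i%C : R[i])^*)%R = - 'i%C by rewrite /=; simpc.
have -> : (- (s%:R * 2 * y * rho (x, y) ^- s.+1))%:C =
  'i%C * s%:R * (toC (x, y) - ((toC (x, y))^*)%R) * (rho (x, y) ^- s.+1)%:C.
  rewrite rmorphN !rmorphM/= !rmorph_nat.
  have -> : toC (x, y) - ((toC (x, y))^*)%R = 2 * y%:C * 'i%C.
    exact: (subcJ (toC (x, y))).
  have i2 : 'i%C * 'i%C = -1 :> R[i] by rewrite -expr2 sqr_i.
  transitivity (('i%C * 'i%C) * (s%:R * 2 * y%:C * (rho (x, y) ^- s.+1)%:C)); last by ring.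
  by rewrite i2; ring.
rewrite !exprS; move: (toC (x, y)) ((toC (x, y))^*)%R => z z'.
(* What remains is linear in the imaginary unit, so it holds with an indeterminate in its place. *)
set I : R[i] := Complex 0 1; move: I => I; ring.
Qed.

(** Serves to prove that the partial derivatives of [wmon] are continuous: they are linear
    combinations of functions [wmon], so no second derivative has to be written out. *)
Definition Cderivable (f : R -> R[i]) := forall t, exists df, is_Cderive f t df.

Lemma CderivableD f g : Cderivable f -> Cderivable g -> Cderivable (fun t => f t + g t).
Proof.
move=> hf hg t; have [df [f1 f2]] := hf t; have [dg [g1 g2]] := hg t.
exists (df + dg); split.
- by under eq_fun do rewrite Re_add; rewrite Re_add; apply: is_deriveD.
- by under eq_fun do rewrite Im_add; rewrite Im_add; apply: is_deriveD.
Qed.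

Lemma CderivableZ c f : Cderivable f -> Cderivable (fun t => c * f t).
Proof.
move=> hf t; have [df hdf] := hf t.
have hc : is_Cderive (fun=> c) t 0 by split => /=; exact: is_derive_cst.
by exists (0 * f t + c * df); exact: is_CderiveM.
Qed.

Lemma Cderivable_continuous f : Cderivable f ->
  continuous (fun t => complex.Re (f t)) /\ continuous (fun t => complex.Im (f t)).
Proof.
move=> hf; split => t; have [df [[f1 _] [f2 _]]] := hf t;
  by apply: differentiable_continuous; apply/derivable1_diffP.
Qed.

(** * Vanishing integrals of partial derivatives *)

Lemma integral_deriv_decay (f F : R -> R) (C : R) :
  leb.-integrable [set: R] (EFin \o f) -> continuous f ->
  (forall x : R, is_derive x 1 F (f x)) ->
  (forall x, `|F x| * `|x| <= C) ->
  (\int[leb]_x (f x)%:E = 0)%E.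
Proof.
move=> intf cf dF hF; apply: (integralT_deriv_eq0 intf cf dF).
- by apply: (@cvgy0_norm_mul_le _ F C) => x x0; rewrite -{2}(ger0_norm (ltW x0)).
- apply/cvgNy_compNP; apply: (@cvgy0_norm_mul_le _ _ C) => x x0.
  by rewrite -{2}(ger0_norm (ltW x0)) -(normrN x); exact: hF.
Qed.

(** The bound on [F] means |F t| <= 1/(1 + t^2); as |t| <= 1 + t^2, both parts of [F] are O(1/|t|)
    and vanish at both ends. *)
Lemma Cintegral_deriv_decay (f F : R -> R[i]) :
  Cintegrable leb f -> Cderivable f -> (forall t, is_Cderive F t (f t)) ->
  (forall t, nrm2 (F t) <= (1 + t ^+ 2) ^- 2) ->
  (\int[leb]_t (complex.Re (f t))%:E = 0)%E /\ (\int[leb]_t (complex.Im (f t))%:E = 0)%E.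
Proof.
move=> [i1 i2] /Cderivable_continuous[c1 c2] dF hF.
have h (t r : R) : `|r| <= (1 + t ^+ 2)^-1 -> `|r| * `|t| <= 1.
  move=> hr; have t0 : 0 < 1 + t ^+ 2 by rewrite ltr_pwDl// sqr_ge0.
  apply: (le_trans (ler_wpM2r (normr_ge0 t) hr)).
  rewrite ler_pdivrMl// mulr1 -(real_normK (num_real t)).
  have := normr_ge0 t; move: `|t| => u u0; nra.
have hp (t : R) : 0 <= (1 + t ^+ 2)^-1 by rewrite invr_ge0 addr_ge0// sqr_ge0.
split.
- apply: (@integral_deriv_decay _ (fun t => complex.Re (F t)) 1) => //.
    by move=> t; have [] := dF t.
  by move=> t; apply: h; apply: norm_Re_le => //; rewrite exprVn.
- apply: (@integral_deriv_decay _ (fun t => complex.Im (F t)) 1) => //.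
    by move=> t; have [] := dF t.
  by move=> t; apply: h; apply: norm_Im_le => //; rewrite exprVn.
Qed.

(* Partial derivatives of [wmon s a b], with [2x = z + zbar] and [2y = -i (z - zbar)]
   expanded; the truncated exponent [0.-1 = 0] always comes with coefficient [0]. *)
Definition wmon_dx s a b (p : R * R) : R[i] :=
  a%:R * wmon s a.-1 b p + b%:R * wmon s a b.-1 p
     + (- s%:R) * (wmon s.+1 a.+1 b p + wmon s.+1 a b.+1 p).

Definition wmon_dy s a b (p : R * R) : R[i] :=
  'i%C * a%:R * wmon s a.-1 b p + (- 'i%C * b%:R) * wmon s a b.-1 p
     + ('i%C * s%:R) * (wmon s.+1 a.+1 b p + (-1) * wmon s.+1 a b.+1 p).

(** For a > 0 the lowered exponent turns the 3 of the hypothesis into the 4 required by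
    [Cintegrable_wmon]; for a = 0 the coefficient is zero. *)
Lemma CintegrableZ_wmon1 c s a b : (a + b + 3 <= 2 * s)%N ->
  Cintegrable lebC (fun p => c * a%:R * wmon s a.-1 b p).
Proof.
case: a => [|a] h; last by apply/CintegrableZ/Cintegrable_wmon; lia.
by apply: eq_Cintegrable (Cintegrable0 _) => p; rewrite mulr0 mul0r.
Qed.

Lemma CintegrableZ_wmon2 c s a b : (a + b + 3 <= 2 * s)%N ->
  Cintegrable lebC (fun p => c * b%:R * wmon s a b.-1 p).
Proof.
case: b => [|b] h; last by apply/CintegrableZ/Cintegrable_wmon; lia.
by apply: eq_Cintegrable (Cintegrable0 _) => p; rewrite mulr0 mul0r.
Qed.

Lemma Cintegrable_wmon_dx s a b : (a + b + 3 <= 2 * s)%N -> Cintegrable lebC (wmon_dx s a b).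
Proof.
move=> h; apply: CintegrableD; first apply: CintegrableD.
- by have := CintegrableZ_wmon1 1 h; under eq_fun do rewrite mul1r.
- by have := CintegrableZ_wmon2 1 h; under eq_fun do rewrite mul1r.
(* Here 3 is exactly enough: (a + 1) + b + 4 <= 2(s + 1). *)
- by apply/CintegrableZ/CintegrableD; apply: Cintegrable_wmon; lia.
Qed.

Lemma Cintegrable_wmon_dy s a b : (a + b + 3 <= 2 * s)%N -> Cintegrable lebC (wmon_dy s a b).
Proof.
move=> h; apply: CintegrableD; first apply: CintegrableD.
- exact: CintegrableZ_wmon1.
- exact: CintegrableZ_wmon2.
- by apply/CintegrableZ/CintegrableD; [|apply: CintegrableZ]; apply: Cintegrable_wmon; lia.
Qed.

Lemma CintegrableZ_wmon_line2 c s a b n (y : R) : (n = 0 \/ a + b + 4 <= 2 * s)%N ->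
  Cintegrable leb (fun x => c * n%:R * wmon s a b (x, y)).
Proof.
case=> [->|h]; last exact/CintegrableZ/Cintegrable_wmon_line2.
by apply: eq_Cintegrable (Cintegrable0 _) => p; rewrite mulr0 mul0r.
Qed.

Lemma CintegrableZ_wmon_line1 c s a b n (x : R) : (n = 0 \/ a + b + 4 <= 2 * s)%N ->
  Cintegrable leb (fun y => c * n%:R * wmon s a b (x, y)).
Proof.
case=> [->|h]; last exact/CintegrableZ/Cintegrable_wmon_line1.
by apply: eq_Cintegrable (Cintegrable0 _) => p; rewrite mulr0 mul0r.
Qed.

Lemma Cintegrable_wmon_dx_line s a b (y : R) : (a + b + 3 <= 2 * s)%N ->
  Cintegrable leb (fun x => wmon_dx s a b (x, y)).
Proof.
move=> h; apply: CintegrableD; first apply: CintegrableD.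
- under eq_fun do rewrite -[a%:R]mul1r.
  by apply: CintegrableZ_wmon_line2; case: a h => [|a]; [left|right; lia].
- under eq_fun do rewrite -[b%:R]mul1r.
  by apply: CintegrableZ_wmon_line2; case: b h => [|b]; [left|right; lia].
- by apply/CintegrableZ/CintegrableD; apply: Cintegrable_wmon_line2; lia.
Qed.

Lemma Cintegrable_wmon_dy_line s a b (x : R) : (a + b + 3 <= 2 * s)%N ->
  Cintegrable leb (fun y => wmon_dy s a b (x, y)).
Proof.
move=> h; apply: CintegrableD; first apply: CintegrableD.
- by apply: CintegrableZ_wmon_line1; case: a h => [|a]; [left|right; lia].
- by apply: CintegrableZ_wmon_line1; case: b h => [|b]; [left|right; lia].
- by apply/CintegrableZ/CintegrableD; [|apply: CintegrableZ]; apply: Cintegrable_wmon_line1; lia.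
Qed.

Lemma Cderivable_wmon1 s a b (y : R) : Cderivable (fun x => wmon s a b (x, y)).
Proof. by move=> x; eexists; exact: is_Cderive_wmon1. Qed.

Lemma Cderivable_wmon2 s a b (x : R) : Cderivable (fun y => wmon s a b (x, y)).
Proof. by move=> y; eexists; exact: is_Cderive_wmon2. Qed.

(** Fubini with the x-integral innermost: on each horizontal line the integrand is the derivative of
    a decaying function. The y-derivative is treated in the same way on vertical lines. *)
Lemma Cintegral_wmon_dx s a b : (a + b + 3 <= 2 * s)%N -> Cintegral lebC (wmon_dx s a b) = 0.
Proof.
move=> h; have [i1 i2] := Cintegrable_wmon_dx h.
have hl (y : R) := Cintegral_deriv_decay (f := fun x => wmon_dx s a b (x, y))
  (F := fun x => wmon s a b (x, y)) (Cintegrable_wmon_dx_line y h).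
have {}hl (y : R) : (\int[leb]_t (complex.Re (wmon_dx s a b (t, y)))%:E = 0)%E /\
     (\int[leb]_t (complex.Im (wmon_dx s a b (t, y)))%:E = 0)%E.
  apply: hl.
  - by do ?[apply: CderivableD|apply: CderivableZ|exact: Cderivable_wmon1].
  - by move=> t; exact: is_Cderive_wmon1.
  - move=> t; apply: (le_trans (nrm2_wmon_le (n := 2) _ _)); first lia.
    by rewrite lef_pV2 ?posrE ?exprn_gt0 ?rho_gt0 ?ltr_pwDl ?sqr_ge0// lerXn2r ?nnegrE
       ?addr_ge0 ?sqr_ge0 ?(ltW (rho_gt0 _))// rhoE addrA lerDl sqr_ge0.
rewrite /Cintegral /Rintegral -(integral21_prod_meas1 i1) -(integral21_prod_meas1 i2).
rewrite /fubini_G /=.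
under eq_integral do rewrite (hl _).1.
rewrite integral0.
by under eq_integral do rewrite (hl _).2; rewrite integral0.
Qed.

Lemma Cintegral_wmon_dy s a b : (a + b + 3 <= 2 * s)%N -> Cintegral lebC (wmon_dy s a b) = 0.
Proof.
move=> h; have [i1 i2] := Cintegrable_wmon_dy h.
have hl (x : R) := Cintegral_deriv_decay (f := fun y => wmon_dy s a b (x, y))
  (F := fun y => wmon s a b (x, y)) (Cintegrable_wmon_dy_line x h).
have {}hl (x : R) : (\int[leb]_t (complex.Re (wmon_dy s a b (x, t)))%:E = 0)%E /\
     (\int[leb]_t (complex.Im (wmon_dy s a b (x, t)))%:E = 0)%E.
  apply: hl.
  - by do ?[apply: CderivableD|apply: CderivableZ|exact: Cderivable_wmon2].
  - by move=> t; exact: is_Cderive_wmon2.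
  - move=> t; apply: (le_trans (nrm2_wmon_le (n := 2) _ _)); first lia.
    by rewrite rho_swap lef_pV2 ?posrE ?exprn_gt0 ?rho_gt0 ?ltr_pwDl ?sqr_ge0// lerXn2r ?nnegrE
       ?addr_ge0 ?sqr_ge0 ?(ltW (rho_gt0 _))// rhoE addrA lerDl sqr_ge0.
rewrite /Cintegral /Rintegral -(integral12_prod_meas1 i1) -(integral12_prod_meas1 i2).
rewrite /fubini_F /=.
under eq_integral do rewrite (hl _).1.
rewrite integral0.
by under eq_integral do rewrite (hl _).2; rewrite integral0.
Qed.

(** * Recursion for the moments I_s(a,b) *)

Definition moment s a b := Cintegral lebC (wmon s a b).

Lemma CintegralZ_wmon c s a b n : (n = 0 \/ a + b + 4 <= 2 * s)%N ->
  Cintegral lebC (fun p => c * n%:R * wmon s a b p) = c * n%:R * moment s a b.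
Proof.
case=> [->|h]; last exact/CintegralZ/Cintegrable_wmon.
rewrite mulr0 mul0r -[RHS](Cintegral0 lebC).
by apply: eq_Cintegral => p; rewrite mul0r.
Qed.

Lemma moment_dx s a b : (a + b + 3 <= 2 * s)%N ->
  a%:R * moment s a.-1 b + b%:R * moment s a b.-1 = s%:R * (moment s.+1 a.+1 b + moment s.+1 a b.+1).
Proof.
move=> h; apply/eqP; rewrite -subr_eq0 -mulNr; apply/eqP; rewrite -(Cintegral_wmon_dx h).
have ha : (a = 0 \/ a.-1 + b + 4 <= 2 * s)%N by case: a h => [|a] h; [left|right; lia].
have hb : (b = 0 \/ a + b.-1 + 4 <= 2 * s)%N by case: b h {ha} => [|b] h; [left|right; lia].
have i1 := CintegrableZ_wmon1 (1 : R[i]) h; have i2 := CintegrableZ_wmon2 (1 : R[i]) h.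
have e1 := CintegralZ_wmon 1 ha; have e2 := CintegralZ_wmon 1 hb.
rewrite !mul1r in i1 i2 e1 e2.
have i3 : Cintegrable lebC (wmon s.+1 a.+1 b) by apply: Cintegrable_wmon; lia.
have i4 : Cintegrable lebC (wmon s.+1 a b.+1) by apply: Cintegrable_wmon; lia.
apply: etrans (esym (CintegralD (CintegrableD i1 i2) (CintegrableZ (- s%:R) (CintegrableD i3 i4)))).
by rewrite (CintegralD i1 i2) e1 e2 (CintegralZ _ (CintegrableD i3 i4)) (CintegralD i3 i4).
Qed.

Lemma moment_dy s a b : (a + b + 3 <= 2 * s)%N ->
  a%:R * moment s a.-1 b - b%:R * moment s a b.-1 = s%:R * (moment s.+1 a b.+1 - moment s.+1 a.+1 b).
Proof.
move=> h; apply/eqP; rewrite -subr_eq0; apply/eqP.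
have ha : (a = 0 \/ a.-1 + b + 4 <= 2 * s)%N by case: a h => [|a] h; [left|right; lia].
have hb : (b = 0 \/ a + b.-1 + 4 <= 2 * s)%N by case: b h {ha} => [|b] h; [left|right; lia].
have e1 := CintegralZ_wmon 'i%C ha; have e2 := CintegralZ_wmon (- 'i%C) hb.
have i1 := CintegrableZ_wmon1 ('i%C : R[i]) h; have i2 := CintegrableZ_wmon2 (- 'i%C : R[i]) h.
have i3 : Cintegrable lebC (wmon s.+1 a.+1 b) by apply: Cintegrable_wmon; lia.
have i4 : Cintegrable lebC (wmon s.+1 a b.+1) by apply: Cintegrable_wmon; lia.
have i5 := CintegrableZ (-1) i4.
have hh : 'i%C * a%:R * moment s a.-1 b + - 'i%C * b%:R * moment s a b.-1
    + 'i%C * s%:R * (moment s.+1 a.+1 b + (-1) * moment s.+1 a b.+1) = 0.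
  rewrite -(Cintegral_wmon_dy h).
  apply: etrans (esym (CintegralD (CintegrableD i1 i2) (CintegrableZ ('i%C * s%:R) (CintegrableD i3 i5)))).
  by rewrite (CintegralD i1 i2) e1 e2 (CintegralZ _ (CintegrableD i3 i5)) (CintegralD i3 i5) (CintegralZ _ i4).
(* Each coefficient in [hh] carries a factor i, which is now cancelled. *)
have i0 : 'i%C != 0 :> R[i] by rewrite eq_complex /= oner_eq0 andbF.
apply: (mulfI i0); rewrite mulr0 -[RHS]hh; ring.
Qed.

Lemma two_neq0 : 2 != 0 :> R[i].
Proof. by rewrite pnatr_eq0. Qed.

(** Half the sum of [moment_dx] and [moment_dy] at (a+1, b), that is, the integral of d/dz of
    z^(a+1) zbar^b rho^-s; the terms from differentiating zbar^b cancel. *)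
Lemma moment_stepl s a b : (a + b + 4 <= 2 * s)%N ->
  a.+1%:R * moment s a b = s%:R * moment s.+1 a.+1 b.+1.
Proof.
move=> h; have h' : (a.+1 + b + 3 <= 2 * s)%N by lia.
have e1 := moment_dx h'; have e2 := moment_dy h'.
apply: (mulfI two_neq0).
transitivity ((a.+1%:R * moment s a b + b%:R * moment s a.+1 b.-1)
  + (a.+1%:R * moment s a b - b%:R * moment s a.+1 b.-1)); first by ring.
rewrite e1 e2; ring.
Qed.

(** Half the difference of the same two identities at (a, b+1), corresponding to d/dzbar. *)
Lemma moment_stepr s a b : (a + b + 4 <= 2 * s)%N ->
  b.+1%:R * moment s a b = s%:R * moment s.+1 a.+1 b.+1.
Proof.
move=> h; have h' : (a + b.+1 + 3 <= 2 * s)%N by lia.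
have e1 := moment_dx h'; have e2 := moment_dy h'.
apply: (mulfI two_neq0).
transitivity ((a%:R * moment s a.-1 b.+1 + b.+1%:R * moment s a b)
  - (a%:R * moment s a.-1 b.+1 - b.+1%:R * moment s a b)); first by ring.
rewrite e1 e2; ring.
Qed.

Lemma moment_neq s a b : (a + b + 4 <= 2 * s)%N -> a != b -> moment s a b = 0.
Proof.
move=> h ab; have := moment_stepl h; rewrite -(moment_stepr h) => /eqP.
rewrite -subr_eq0 -mulrBl mulf_eq0 => /orP[|/eqP//].
by rewrite subr_eq0 eqr_nat eqSS (negbTE ab).
Qed.

(** One factor rho = 1 + z zbar is split off the weight. This links moments with equal exponents and
    different s, whereas the step identities shift all three indices together. *)
Lemma moment_rho s a b : (a + b + 4 <= 2 * s)%N ->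
  moment s a b = moment s.+1 a b + moment s.+1 a.+1 b.+1.
Proof.
move=> h; rewrite /moment -CintegralD; [|by apply: Cintegrable_wmon; lia..].
apply: eq_Cintegral => p; rewrite /wmon.
have r0 : (rho p)%:C != 0 by rewrite eq_complex /= gt_eqF// rho_gt0.
have -> : (rho p ^- s)%:C = (rho p)%:C * (rho p ^- s.+1)%:C.
  rewrite -rmorphM /= exprS invfM mulrA mulfV ?mul1r//.
  by rewrite gt_eqF// rho_gt0.
have -> : (rho p)%:C = 1 + toC p * ((toC p)^*)%R by rewrite -nrm2E /rho rmorphD rmorph1.
rewrite !exprS; ring.
Qed.

Lemma moment2_00 : moment 2 0 0 = pi%:C.
Proof.
rewrite /moment /Cintegral.
congr (_ +i* _).
- rewrite /Rintegral -[RHS]/(fine pi%:E) -integral_rho2; congr fine.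
  by apply: eq_integral => p _; rewrite /wmon !expr0 !mul1r.
- rewrite /Rintegral integral0_eq// => p _.
  by rewrite /wmon !expr0 !mul1r.
Qed.

(** With s = n + 2, [moment_rho] gives I_(s+1)(0,0) = I_s(0,0) - I_(s+1)(1,1), and [moment_stepl]
    gives s I_(s+1)(1,1) = I_s(0,0). Hence s I_(s+1)(0,0) = (s - 1) I_s(0,0). *)
Lemma moment_00 n : n.+1%:R * moment n.+2 0 0 = pi%:C.
Proof.
elim: n => [|n IH]; first by rewrite mul1r moment2_00.
have h : (0 + 0 + 4 <= 2 * n.+2)%N by lia.
have e1 := moment_stepl h; have e2 := moment_rho h.
rewrite -IH.
have -> : moment n.+3 0 0 = moment n.+2 0 0 - moment n.+3 1 1 by rewrite e2 addrK.
rewrite mulrBr -e1 -[in n.+2%:R]natr1; ring.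
Qed.

(** Induction raising a and t together: the factors in [moment_stepl] match (a+1) C(t+1,a+1) = (t+1)
    C(t,a). After normalization this is the squared norm 1/C(t,a) of z^a in H_t. *)
Lemma moment_diag t a : (a <= t)%N ->
  t.+1%:R * 'C(t, a)%:R * moment t.+2 a a = pi%:C.
Proof.
elim: a t => [|a IH] t; first by rewrite bin0 mulr1 => _; exact: moment_00.
case: t => [//|t]; rewrite ltnS => at_.
have h : (a + a + 4 <= 2 * t.+2)%N by lia.
rewrite -(IH _ at_).
have e := moment_stepl h.
have nz : a.+1%:R != 0 :> R[i] by rewrite pnatr_eq0.
have hb : a.+1%:R * 'C(t.+1, a.+1)%:R = t.+1%:R * 'C(t, a)%:R :> R[i].
  by rewrite -!natrM mul_bin_diag.
apply: (mulfI nz).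
transitivity ((a.+1%:R * 'C(t.+1, a.+1)%:R) * (t.+2%:R * moment t.+3 a.+1 a.+1)); first by ring.
rewrite hb -e; ring.
Qed.

End Plane.

(** * Products of integrals *)

(* The library's own sigma-finite instance on [m1 \x m2] is hidden by the one
   declared for subprobability measures, so it is repacked here. *)
Definition product_sigma_finite (d1 d2 : measure_display) (T1 : measurableType d1)
    (T2 : measurableType d2) (R : realType) (m1 : {sigma_finite_measure set T1 -> \bar R})
    (m2 : {sigma_finite_measure set T2 -> \bar R}) :
    {sigma_finite_measure set ((T1 * T2)%type : measurableType _) -> \bar R} :=
  HB.pack (m1 \x m2)%E
   (lebesgue_integral_fubini.measure_function_Measure_isSigmaFinite__to__measure_function_isSigmaFinite m1 m2)
   (lebesgue_integral_fubini.measure_function_Measure_isSigmaFinite__to__measure_function_isSFinite m1 m2).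

Section ProductIntegral.
Context (d1 d2 d3 : measure_display) (T1 : measurableType d1) (T2 : measurableType d2)
  (T3 : measurableType d3) (R : realType).
Variables (m1 : {sigma_finite_measure set T1 -> \bar R})
  (m2 : {sigma_finite_measure set T2 -> \bar R})
  (m3 : {sigma_finite_measure set T3 -> \bar R}).
Local Notation M := (((m1 \x m2) \x m3)%E).
Local Notation N := ((m2 \x m3)%E).

Lemma measurable_product_rule (f : T1 -> R) (g : T2 * T3 -> R) :
  measurable_fun setT f -> measurable_fun setT g ->
  measurable_fun setT (fun p : T1 * T2 * T3 => f p.1.1 * g (p.1.2, p.2)).
Proof.
move=> mf mg; apply: measurable_funM.
- apply: (measurableT_comp mf).
  exact: (measurableT_comp measurable_fst measurable_fst).
- apply: (measurableT_comp mg); apply/measurable_fun_pairP; split => /=.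
    exact: (measurableT_comp measurable_snd measurable_fst).
  exact: measurable_snd.
Qed.

(** The product measure is nested to the left, as for the coordinates of C^2, but [g] couples the
    last two factors. Tonelli therefore integrates out [T3], then [T2], and is applied to [N] as
    well to recognize the integral of [g]. *)
Lemma ge0_integral_product_rule (f : T1 -> R) (g : T2 * T3 -> R) :
  measurable_fun setT f -> measurable_fun setT g ->
  (forall x, 0 <= f x) -> (forall y, 0 <= g y) ->
  (\int[M]_p (f p.1.1 * g (p.1.2, p.2))%:E = (\int[m1]_x (f x)%:E) * \int[N]_y (g y)%:E)%E.
Proof.
move=> mf mg f0 g0.
have mgE : measurable_fun setT (EFin \o g) by exact/measurable_EFinP.
have mG := measurable_fun_fubini_tonelli_F (m2 := m3) _ mgE.
have mfg := measurable_product_rule mf mg.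
pose m12 := product_sigma_finite m1 m2.
transitivity (\int[(m12 \x m3)%E]_p (f p.1.1 * g (p.1.2, p.2))%:E)%E; first by [].
rewrite (fubini_tonelli1 (m1 := m12) (m2 := m3) (fun p => (f p.1.1 * g (p.1.2, p.2))%:E)); last 2 first.
- by apply/measurable_EFinP; apply: mfg.
- by move=> p; rewrite lee_fin mulr_ge0.
rewrite /fubini_F.
pose G y := (\int[m3]_z (g (y, z))%:E)%E.
have G_ge0 y : (0 <= G y)%E by apply: integral_ge0 => z _; rewrite lee_fin.
have mG' : measurable_fun setT G by apply: mG => y; rewrite lee_fin.
have inner (q : T1 * T2) : (\int[m3]_z (f q.1 * g (q.2, z))%:E = (f q.1)%:E * G q.2)%E.
  under eq_integral do rewrite EFinM.
  rewrite ge0_integralZl//.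
  - apply/measurable_EFinP; exact: (measurableT_comp mg (pair1_measurable q.2)).
  - by move=> z _; rewrite lee_fin.
  - by rewrite lee_fin.
under eq_integral do rewrite inner.
transitivity (\int[(m1 \x m2)%E]_q ((f q.1)%:E * G q.2))%E; first by [].
rewrite (fubini_tonelli1 (m1 := m1) (m2 := m2) (fun q => (f q.1)%:E * G q.2))%E; last 2 first.
- apply: emeasurable_funM.
    have mfE : measurable_fun setT (EFin \o f) by exact/measurable_EFinP.
    exact: (measurableT_comp mfE measurable_fst).
  exact: (measurableT_comp mG' measurable_snd).
- by move=> p; rewrite mule_ge0// lee_fin.
rewrite /fubini_F /=.
have -> : (\int[N]_y (g y)%:E = \int[m2]_y G y)%E.
  by rewrite fubini_tonelli1//= => y; rewrite lee_fin.
rewrite -ge0_integralZr//; last 3 first.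
- exact/measurable_EFinP.
- by move=> x _; rewrite lee_fin.
- by apply: integral_ge0.
by apply: eq_integral => x _; rewrite ge0_integralZl// lee_fin.
Qed.

(** Integrability is bundled with the factorization because additivity of the integral needs it when
    passing to differences. *)
Definition product_rule (f : T1 -> R) (g : T2 * T3 -> R) :=
  M.-integrable setT (EFin \o (fun p => f p.1.1 * g (p.1.2, p.2))) /\
  \int[M]_p (f p.1.1 * g (p.1.2, p.2)) = (\int[m1]_x f x) * \int[N]_y g y.

Lemma ge0_product_rule (f : T1 -> R) (g : T2 * T3 -> R) :
  m1.-integrable setT (EFin \o f) -> N.-integrable setT (EFin \o g) ->
  (forall x, 0 <= f x) -> (forall y, 0 <= g y) -> product_rule f g.
Proof.
move=> if_ ig f0 g0.
have mf : measurable_fun setT f by apply/measurable_EFinP; case/integrableP: if_.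
have mg : measurable_fun setT g by apply/measurable_EFinP; case/integrableP: ig.
have e := ge0_integral_product_rule mf mg f0 g0.
have ff := integrable_fin_num _ if_; have fg := integrable_fin_num _ ig.
split.
- have mfg := measurable_product_rule mf mg.
  apply/integrableP; split.
    by apply/measurable_EFinP; apply: mfg.
  under eq_integral do rewrite gee0_abs ?lee_fin ?mulr_ge0//.
  rewrite e -(fineK (ff _)) // -(fineK (fg _)) // -EFinM.
  exact: ltry.
- by rewrite /Rintegral e fineM//; [exact: ff|exact: fg].
Qed.

Lemma integrable_normB d (T : measurableType d) (m : {measure set T -> \bar R}) (f : T -> R) :
  m.-integrable setT (EFin \o f) ->
  m.-integrable setT (EFin \o (fun x => `|f x|)) /\
  m.-integrable setT (EFin \o (fun x => `|f x| - f x)).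
Proof.
move=> h; have h' := integrable_norm h; split; first exact: h'.
exact: RintegrableB.
Qed.

Lemma product_ruleBl f1 f2 g : m1.-integrable setT (EFin \o f1) -> m1.-integrable setT (EFin \o f2) ->
  product_rule f1 g -> product_rule f2 g -> product_rule (fun x => f1 x - f2 x) g.
Proof.
move=> h1 h2 [i1 e1] [i2 e2]; split.
- by under eq_fun do rewrite mulrBl; exact: RintegrableB.
- under eq_Rintegral do rewrite mulrBl.
  by rewrite !RintegralB// e1 e2 mulrBl.
Qed.

Lemma product_ruleBr f g1 g2 : N.-integrable setT (EFin \o g1) -> N.-integrable setT (EFin \o g2) ->
  product_rule f g1 -> product_rule f g2 -> product_rule f (fun x => g1 x - g2 x).
Proof.
move=> h1 h2 [i1 e1] [i2 e2]; split.
- by under eq_fun do rewrite mulrBr; exact: RintegrableB.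
- under eq_Rintegral do rewrite mulrBr.
  by rewrite !RintegralB// e1 e2 mulrBr.
Qed.

(* [|f|] and [|f| - f] are nonnegative, so Tonelli applies to both parts of
   [f = |f| - (|f| - f)]; no almost-everywhere finiteness issue arises. *)
Lemma integrable_product_rule (f : T1 -> R) (g : T2 * T3 -> R) :
  m1.-integrable setT (EFin \o f) -> N.-integrable setT (EFin \o g) -> product_rule f g.
Proof.
move=> if_ ig.
have [f1 f2] := integrable_normB if_; have [g1 g2] := integrable_normB ig.
have B0 (r : R) : 0 <= `|r| - r by rewrite subr_ge0 ler_norm.
have key h : N.-integrable setT (EFin \o h) -> (forall y, 0 <= h y) -> product_rule f h.
  move=> ih h0.
  rewrite (_ : f = fun x => `|f x| - (`|f x| - f x)); last by apply/funext => x; rewrite subKr.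
  by apply: product_ruleBl => //; apply: ge0_product_rule.
rewrite (_ : g = fun x => `|g x| - (`|g x| - g x)); last by apply/funext => x; rewrite subKr.
by apply: product_ruleBr => //; apply: key.
Qed.

Lemma Cintegral_product_rule (f : T1 -> R[i]) (g : T2 * T3 -> R[i]) :
  Cintegrable m1 f -> Cintegrable N g ->
  Cintegrable M (fun p => f p.1.1 * g (p.1.2, p.2)) /\
  Cintegral M (fun p => f p.1.1 * g (p.1.2, p.2)) = Cintegral m1 f * Cintegral N g.
Proof.
move=> [f1 f2] [g1 g2].
have [i11 e11] := integrable_product_rule f1 g1; have [i12 e12] := integrable_product_rule f1 g2.
have [i21 e21] := integrable_product_rule f2 g1; have [i22 e22] := integrable_product_rule f2 g2.
split; first split.
- by under eq_fun do rewrite Re_mul; exact: RintegrableB.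
- by under eq_fun do rewrite Im_mul; exact: RintegrableD.
rewrite /Cintegral.
under eq_Rintegral do rewrite Re_mul.
rewrite RintegralB// e11 e22.
under [X in _ +i* X]eq_Rintegral do rewrite Im_mul.
by rewrite RintegralD// e12 e21.
Qed.
End ProductIntegral.

(** * Binomial sums *)

(** Equates coefficients of t^k in (1-t)^-(a+1) (1-t)^-(b+1) = (1-t)^-(a+b+2). The proof is a double
    induction on b and k through Pascal's rule. *)
Lemma sum_bin_conv a b k :
  (\sum_(l < k.+1) 'C(a + l, l) * 'C(b + (k - l), k - l) = 'C(a + b + k.+1, k))%N.
Proof.
elim: b k => [|b IHb] k.
  (* The case b = 0 is the hockey-stick identity. *)
  elim: k => [|k IHk]; first by rewrite big_ord1 !bin0.
  rewrite big_ord_recr /= subnn addn0 bin0 muln1.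
  under eq_bigr => i _ do rewrite add0n binn muln1.
  have {}IHk : (\sum_(i < k.+1) 'C(a + i, i) = 'C(a + k.+1, k))%N.
    by rewrite -[a in RHS]addn0 -IHk; apply: eq_bigr => i _; rewrite add0n binn muln1.
  by rewrite IHk addn0 [in RHS]addnS binS addnC.
elim: k => [|k IHk]; first by rewrite big_ord1 !bin0.
rewrite big_ord_recr /= subnn addn0 bin0 muln1.
(* Pascal's rule on the second factor splits the sum into the instances (b, k+1) and (b+1, k); the
   last summand, kept apart, completes the first of them. *)
under eq_bigr => i _.
  have -> : (k.+1 - i = (k - i).+1)%N by rewrite subSn// -ltnS.
  rewrite addSn binS mulnDr -addSnnS; over.
rewrite big_split /=.
have := IHb k.+1; rewrite big_ord_recr /= subnn addn0 bin0 muln1 => h.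
have -> : (a + b.+1 + k.+2 = (a + b + k.+2).+1)%N by lia.
rewrite binS -h -addnA [X in (_ + X)%N]addnC addnA; congr (_ + _)%N.
  congr (_ + _)%N; apply: eq_bigr => i _; congr (_ * _)%N.
  have -> : (k.+1 - i = (k - i).+1)%N by rewrite subSn// -ltnS.
  by rewrite addSnnS.
rewrite (_ : a + b + k.+2 = a + b.+1 + k.+1)%N; last lia.
by rewrite -IHk.
Qed.

Lemma ffactnD n a b : (n ^_ (a + b) = n ^_ a * (n - a) ^_ b)%N.
Proof.
elim: b => [|b IH]; first by rewrite addn0 ffactn0 muln1.
by rewrite addnS !ffactnSr IH mulnA subnDA.
Qed.

(** The falling factorial of mu is cut after k - l factors and that of nu after l; each piece is a
    binomial times a factorial, and the factorials combine with C(k,l) into k!. *)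
Lemma bin_sqr_ffact mu nu k l : (k <= mu)%N -> (k <= nu)%N -> (l <= k)%N ->
  ('C(k, l) ^ 2 * (mu ^_ k * nu ^_ k) =
   ('C(mu, k - l) * 'C(nu, l)) * (k`! ^ 2 * ('C(mu - k + l, l) * 'C(nu - k + (k - l), k - l))))%N.
Proof.
move=> km kn lk.
have hmu : (mu ^_ k = 'C(mu, k - l) * (k - l)`! * ('C(mu - k + l, l) * l`!))%N.
  rewrite -{1}(subnK lk) ffactnD -!bin_ffact; congr (_ * (_ * _))%N.
  by congr 'C(_, _); lia.
have hnu : (nu ^_ k = 'C(nu, l) * l`! * ('C(nu - k + (k - l), k - l) * (k - l)`!))%N.
  rewrite -{1}(subnKC lk) ffactnD -!bin_ffact; congr (_ * (_ * _))%N.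
  by congr 'C(_, _); lia.
by rewrite hmu hnu -(bin_fact lk); lia.
Qed.

Section Rising.
Context {R : realType}.

Lemma risingN n k : (k <= n)%N -> rising (- n%:R : R[i]) k = (-1) ^+ k * (n ^_ k)%:R.
Proof.
elim: k => [|k IH] kn; first by rewrite /rising big_ord0 ffactn0 mulr1 expr0.
rewrite /rising big_ord_recr /= -/(rising _ _) IH ?(ltnW kn)// ffactnSr natrM natrB ?(ltnW kn)//.
by rewrite exprS; ring.
Qed.

Lemma rising_nat n k : rising (n.+1%:R : R[i]) k = ((n + k) ^_ k)%:R.
Proof.
elim: k => [|k IH]; first by rewrite /rising big_ord0 ffactn0.
rewrite /rising big_ord_recr /= -/(rising _ _) IH addnS ffactSS natrM mulrC -natrD.
by rewrite addSn.
Qed.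

(** By [bin_sqr_ffact] each summand is k!^2 / (mu^_k nu^_k) times a summand of [sum_bin_conv] with a
    = mu - k and b = nu - k. One k! turns the resulting binomial C(mu+nu-k+1, k) into the Pochhammer
    symbol; the signs of the two others cancel. *)
Lemma sum_bin_norm mu nu k : (k <= mu)%N -> (mu < nu)%N ->
  \sum_(l < k.+1) 'C(k, l)%:R ^+ 2 / ('C(mu, k - l)%:R * 'C(nu, l)%:R) =
   (k`!)%:R * rising ((mu + nu - 2 * k + 2)%:R : R[i]) k
        / (rising (- (nu%:R)) k * rising (- (mu%:R)) k).
Proof.
move=> km mn; have kn : (k <= nu)%N by lia.
have -> : (mu + nu - 2 * k + 2 = ((mu - k) + (nu - k) + 1).+1)%N by lia.
rewrite rising_nat !risingN//.
have -> : (-1) ^+ k * (nu ^_ k)%:R * ((-1) ^+ k * (mu ^_ k)%:R) = (mu ^_ k * nu ^_ k)%:R :> R[i].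
  rewrite natrM mulrACA -exprD -signr_odd addnn odd_double expr0 mul1r mulrC//.
have f0 n : (k <= n)%N -> (n ^_ k)%:R != 0 :> R[i] by move=> ?; rewrite pnatr_eq0 -lt0n ffact_gt0.
rewrite -bin_ffact.
have -> : (mu - k + (nu - k) + 1 + k = (mu - k) + (nu - k) + k.+1)%N by lia.
rewrite -sum_bin_conv natrM natr_sum mulrA mulrAC -mulrA -[RHS]mulrA.
transitivity ((\sum_(l < k.+1) ('C(mu - k + l, l) * 'C(nu - k + (k - l), k - l))%:R) *
   ((k`!)%:R ^+ 2 / (mu ^_ k * nu ^_ k)%:R) : R[i]); last by rewrite expr2; ring.
rewrite mulr_suml; apply: eq_bigr => l _.
have lk : (l <= k)%N by rewrite -ltnS.
have := bin_sqr_ffact km kn lk => /(congr1 (fun n : nat => n%:R : R[i])).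
rewrite !natrM => h.
have c1 : 'C(mu, k - l)%:R != 0 :> R[i] by rewrite pnatr_eq0 -lt0n bin_gt0; lia.
have c2 : 'C(nu, l)%:R != 0 :> R[i] by rewrite pnatr_eq0 -lt0n bin_gt0; lia.
rewrite mulrA; apply/eqP; rewrite eqr_div ?mulf_neq0 ?f0//.
by apply/eqP; rewrite expr2 h; ring.
Qed.
End Rising.

(** * The operators [J_k] *)

Section Main.
Context {R : realType}.
Notation leb := (@lebesgue_measure R : {sigma_finite_measure set (measurableTypeR R) -> \bar R}).
Notation lebC := ((leb \x leb)%E).
Notation lebC2 := ((((leb \x leb) \x leb) \x leb)%E).
Implicit Types (f : R[i] -> R[i] -> R[i]).

Lemma Re_mulC (z : R[i]) (r : R) : complex.Re (z * r%:C) = complex.Re z * r.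
Proof. by rewrite Re_mul /= mulr0 subr0. Qed.

Lemma Im_mulC (z : R[i]) (r : R) : complex.Im (z * r%:C) = complex.Im z * r.
Proof. by rewrite Im_mul /= mulr0 add0r. Qed.

Lemma cintE tau (f : R[i] -> R[i]) :
  cint tau f = Cintegral lebC (fun p => f (toC p) * (iota_dens tau (toC p))%:C).
Proof.
by rewrite /cint /Cintegral; congr (_ +i* _); apply: eq_Rintegral => p _;
  rewrite ?Re_mulC ?Im_mulC.
Qed.

Definition dens2 mu nu (f : R[i] -> R[i] -> R[i]) (p : R * R * R * R) : R[i] :=
  f (toC p.1.1) (toC (p.1.2, p.2)) * (iota_dens mu (toC p.1.1))%:C
    * (iota_dens nu (toC (p.1.2, p.2)))%:C.

Lemma c2intE mu nu f : c2int mu nu f = Cintegral lebC2 (dens2 mu nu f).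
Proof.
by rewrite /c2int /Cintegral; congr (_ +i* _); apply: eq_Rintegral => p _;
  rewrite /dens2 ?Re_mulC ?Im_mulC.
Qed.

Definition c2integrable mu nu f := Cintegrable lebC2 (dens2 mu nu f).

Lemma eq_c2integrable mu nu f g : (forall z w, f z w = g z w) -> c2integrable mu nu f -> c2integrable mu nu g.
Proof. by move=> h; apply: eq_Cintegrable => p; rewrite /dens2 h. Qed.

Lemma eq_c2int mu nu f g : (forall z w, f z w = g z w) -> c2int mu nu f = c2int mu nu g.
Proof. by move=> h; rewrite !c2intE; apply: eq_Cintegral => p; rewrite /dens2 h. Qed.

Lemma c2integrableZ mu nu c f : c2integrable mu nu f -> c2integrable mu nu (fun z w => c * f z w).
Proof.
by move=> h; apply: eq_Cintegrable (CintegrableZ c h) => p; rewrite /dens2 !mulrA.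
Qed.

Lemma c2intZ mu nu c f : c2integrable mu nu f -> c2int mu nu (fun z w => c * f z w) = c * c2int mu nu f.
Proof.
move=> h; rewrite !c2intE -(CintegralZ _ h).
by apply: eq_Cintegral => p; rewrite /dens2 !mulrA.
Qed.

Lemma c2integrable_sum mu nu n (F : 'I_n -> R[i] -> R[i] -> R[i]) :
  (forall i, c2integrable mu nu (F i)) -> c2integrable mu nu (fun z w => \sum_(i < n) F i z w).
Proof.
move=> h; apply: eq_Cintegrable (Cintegrable_sum (index_enum _) (P := xpredT) (fun i _ => h i)).
by move=> p; rewrite /dens2 !mulr_suml.
Qed.

Lemma c2int_sum mu nu n (F : 'I_n -> R[i] -> R[i] -> R[i]) :
  (forall i, c2integrable mu nu (F i)) ->
  c2int mu nu (fun z w => \sum_(i < n) F i z w) = \sum_(i < n) c2int mu nu (F i).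
Proof.
move=> h; under eq_bigr do rewrite c2intE.
rewrite c2intE -(Cintegral_sum (index_enum _) (P := xpredT) (fun i _ => h i)).
by apply: eq_Cintegral => p; rewrite /dens2 !mulr_suml.
Qed.

Lemma c2int_conj mu nu f : c2integrable mu nu f ->
  c2int mu nu (fun z w => ((f z w)^*)%R) = ((c2int mu nu f)^*)%R.
Proof.
move=> h; rewrite !c2intE -(Cintegral_conj h).
have hr (r : R) : ((r%:C : R[i])^*)%R = r%:C := conjc_real r.
apply: eq_Cintegral => p; rewrite /dens2 2!(rmorphM Num.conj).
by congr (_ * _ * _); exact: (esym (hr _)).
Qed.

(** * Inner products of monomials *)

Definition monomial_ip tau a b : R[i] := (a == b)%:R / 'C(tau, a)%:R.

Lemma wmon_iota_dens tau a b (p : R * R) :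
  toC p ^+ a * ((toC p)^*)%R ^+ b * (iota_dens tau (toC p))%:C =
  (tau.+1%:R / pi)%:C * wmon tau.+2 a b p.
Proof.
rewrite /wmon /iota_dens -/(rho p).
have -> : tau.+1%:R / rho p ^+ tau / (pi * rho p ^+ 2) = (tau.+1%:R / pi) * rho p ^- tau.+2.
  have -> : rho p ^+ tau.+2 = rho p ^+ tau * rho p ^+ 2 by rewrite -exprD addn2.
  by rewrite !invfM; ring.
rewrite rmorphM; ring.
Qed.

Lemma Cintegrable_monomial tau a b : (a <= tau)%N -> (b <= tau)%N ->
  Cintegrable lebC (fun p => toC p ^+ a * ((toC p)^*)%R ^+ b * (iota_dens tau (toC p))%:C).
Proof.
move=> ha hb; apply: eq_Cintegrable (CintegrableZ (tau.+1%:R / pi)%:C (Cintegrable_wmon (s := tau.+2) (a := a) (b := b) _)).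
  by move=> p; rewrite wmon_iota_dens.
by lia.
Qed.

Lemma Cintegral_monomial tau a b : (a <= tau)%N -> (b <= tau)%N ->
  Cintegral lebC (fun p => toC p ^+ a * ((toC p)^*)%R ^+ b * (iota_dens tau (toC p))%:C)
   = monomial_ip tau a b.
Proof.
move=> ha hb; have h : (a + b + 4 <= 2 * tau.+2)%N by lia.
under eq_Cintegral do rewrite wmon_iota_dens.
rewrite CintegralZ; last exact: Cintegrable_wmon.
rewrite -/(moment _ _ _) /monomial_ip.
have [<-|ab] := eqVneq a b; last by rewrite (moment_neq h ab) mulr0 mul0r.
have e := @moment_diag R _ _ ha.
have c0 : 'C(tau, a)%:R != 0 :> R[i] by rewrite pnatr_eq0 -lt0n bin_gt0.
have p0 : (pi : R)%:C != 0 by rewrite eq_complex /= gt_eqF// pi_gt0.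
apply: (mulIf c0); rewrite mulfVK// fmorph_div rmorph_nat.
transitivity ((tau.+1%:R * 'C(tau, a)%:R * moment tau.+2 a a) / (pi : R)%:C); first by ring.
by rewrite e mulfV.
Qed.

Definition bimonomial a b c d (z w : R[i]) : R[i] :=
  z ^+ a * (z^*)%R ^+ b * (w ^+ c * (w^*)%R ^+ d).

Lemma c2int_bimonomial mu nu a b c d : (a <= mu)%N -> (b <= mu)%N -> (c <= nu)%N -> (d <= nu)%N ->
  c2integrable mu nu (bimonomial a b c d) /\ c2int mu nu (bimonomial a b c d) = monomial_ip mu a b * monomial_ip nu c d.
Proof.
move=> ha hb hc hd.
have [i e] := Cintegral_product_rule (m1 := product_sigma_finite leb leb) (m2 := leb) (m3 := leb)
  (Cintegrable_monomial ha hb) (Cintegrable_monomial hc hd).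
have dE p : dens2 mu nu (bimonomial a b c d) p =
  (toC p.1.1 ^+ a * ((toC p.1.1)^*)%R ^+ b * (iota_dens mu (toC p.1.1))%:C) *
  (toC (p.1.2, p.2) ^+ c * ((toC (p.1.2, p.2))^*)%R ^+ d * (iota_dens nu (toC (p.1.2, p.2)))%:C).
  by rewrite /dens2 /bimonomial; ring.
split; first by apply: eq_Cintegrable i => p; rewrite dE.
rewrite c2intE -!Cintegral_monomial// -e.
by apply: eq_Cintegral => p; rewrite dE.
Qed.

Definition signed_bin k l : R[i] := (-1) ^+ l *+ 'C(k, l).

Lemma exprB_signed_bin (x y : R[i]) k :
  (x - y) ^+ k = \sum_(l < k.+1) signed_bin k l * (x ^+ (k - l) * y ^+ l).
Proof.
rewrite exprBn; apply: eq_bigr => l _; rewrite /signed_bin -mulrnAl.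
by rewrite -!mulrnAl mulrA.
Qed.

(** * Expansion of J_k F in powers of xi *)

(** After expanding (zbar - wbar)^k the conjugate exponents are k - l + p and l + q; the bounds on p
    and q keep them at most mu and nu, where monomials are known to be integrable. *)
Lemma c2integrable_Jcoef mu nu k (F : R[i] -> R[i] -> R[i]) p q :
  inTensor mu nu F -> (k <= mu)%N -> (k <= nu)%N -> (p <= mu - k)%N -> (q <= nu - k)%N ->
  c2integrable mu nu (fun z w => F z w * (z^* - w^*)%R ^+ k * (z^*)%R ^+ p * (w^*)%R ^+ q).
Proof.
move=> [a aE] km kn hp hq.
apply: (@eq_c2integrable _ _ (fun z w => \sum_(i < mu.+1) \sum_(j < nu.+1) \sum_(l < k.+1)
   (a i j * signed_bin k l) * bimonomial i (k - l + p) j (l + q) z w)); last first.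
  apply: c2integrable_sum => i; apply: c2integrable_sum => j; apply: c2integrable_sum => l.
  have lk : (l <= k)%N by rewrite -ltnS.
  by apply: c2integrableZ; apply: (c2int_bimonomial _ _ _ _).1; [rewrite -ltnS|lia|rewrite -ltnS|lia].
move=> z w; rewrite aE -!mulrA mulr_suml; apply: eq_bigr => i _.
rewrite mulr_suml; apply: eq_bigr => j _.
rewrite exprB_signed_bin mulr_suml mulr_sumr; apply: eq_bigr => l _.
by rewrite /bimonomial !exprD; ring.
Qed.

Lemma expr1D_bin (x : R[i]) n : (1 + x) ^+ n = \sum_(p < n.+1) 'C(n, p)%:R * x ^+ p.
Proof. by rewrite addrC exprD1n; apply: eq_bigr => p _; rewrite mulr_natl. Qed.

(** The contribution of zbar^p wbar^q to the coefficient of xi^(p+q) in J_k F, without its binomial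
    factors. *)
Definition Jcoef mu nu k F p q :=
  c2int mu nu (fun z w : R[i] => F z w * (z^* - w^*)%R ^+ k * (z^*)%R ^+ p * (w^*)%R ^+ q).

Lemma JkE mu nu k (F : R[i] -> R[i] -> R[i]) xi : inTensor mu nu F -> (k <= mu)%N -> (k <= nu)%N ->
  Jk mu nu k F xi = \sum_(p < (mu - k).+1) \sum_(q < (nu - k).+1)
     'C(mu - k, p)%:R * 'C(nu - k, q)%:R * Jcoef mu nu k F p q * xi ^+ (p + q).
Proof.
move=> tF km kn; rewrite /Jk.
have intF (p : 'I_(mu - k).+1) (q : 'I_(nu - k).+1) := c2integrable_Jcoef tF km kn (ltn_ord p) (ltn_ord q).
rewrite (@eq_c2int _ _ _ (fun z w => \sum_(p < (mu - k).+1) \sum_(q < (nu - k).+1)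
  ('C(mu - k, p)%:R * 'C(nu - k, q)%:R * xi ^+ (p + q)) *
  (F z w * (z^* - w^*)%R ^+ k * (z^*)%R ^+ p * (w^*)%R ^+ q))); last first.
  move=> z w; rewrite !expr1D_bin -mulrA mulr_suml mulr_sumr; apply: eq_bigr => p _.
  rewrite !mulr_sumr; apply: eq_bigr => q _.
  by rewrite !exprMn exprD; ring.
rewrite c2int_sum; last first.
  by move=> p; apply: c2integrable_sum => q; apply: c2integrableZ; exact: intF.
apply: eq_bigr => p _; rewrite c2int_sum; last by move=> q; apply: c2integrableZ; exact: intF.
apply: eq_bigr => q _; rewrite c2intZ; last exact: intF.
by rewrite -/(Jcoef _ _ _ _ _ _); ring.
Qed.

Lemma Jk0 mu nu k (F : R[i] -> R[i] -> R[i]) : Jk mu nu k F 0 = Jcoef mu nu k F 0 0.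
Proof.
by apply: eq_c2int => z w; rewrite !mul0r !addr0 !expr1n !expr0 !mulr1.
Qed.

(** Positive powers of xi are orthogonal to 1 and 1 has norm 1, so only p = q = 0 survives. The
    double sum has the shape delivered by [JkE]. *)
Lemma ipH_const tau n m (c : nat -> nat -> R[i]) (h : R[i] -> R[i]) : (n + m <= tau)%N ->
  (forall xi, h xi = \sum_(p < n.+1) \sum_(q < m.+1) c p q * xi ^+ (p + q)) ->
  ipH tau h (fun=> 1) = c 0 0.
Proof.
move=> nm hE; rewrite /ipH cintE.
have hp (p : 'I_n.+1) (q : 'I_m.+1) : (p + q <= tau)%N.
  by have := ltn_ord p; have := ltn_ord q; lia.
have intF (p : 'I_n.+1) (q : 'I_m.+1) :=
  CintegrableZ (c p q) (Cintegrable_monomial (hp p q) (leq0n tau)).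
transitivity (Cintegral lebC (fun x => \sum_(p < n.+1) \sum_(q < m.+1)
  c p q * (toC x ^+ (p + q) * ((toC x)^*)%R ^+ 0 * (iota_dens tau (toC x))%:C))).
  apply: eq_Cintegral => x; rewrite hE rmorph1 mulr1 mulr_suml; apply: eq_bigr => p _.
  by rewrite mulr_suml; apply: eq_bigr => q _; rewrite expr0 mulr1 mulrA.
rewrite Cintegral_sum; last by move=> p _; apply: Cintegrable_sum => q _; exact: intF.
rewrite big_ord_recl /= [X in _ + X]big1 ?addr0; last first.
  move=> p _; rewrite Cintegral_sum; last by move=> q _; exact: (intF (lift ord0 p) q).
  apply: big1 => q _; rewrite CintegralZ ?Cintegral_monomial ?(hp (lift ord0 p) q)//; last first.
    exact: (Cintegrable_monomial (hp (lift ord0 p) q) (leq0n _)).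
  by rewrite /monomial_ip /= mul0r mulr0.
rewrite Cintegral_sum; last by move=> q _; exact: (intF ord0 q).
rewrite big_ord_recl /= [X in _ + X]big1 ?addr0; last first.
  move=> q _; rewrite CintegralZ ?Cintegral_monomial ?(hp ord0 (lift ord0 q))//; last first.
    exact: (Cintegrable_monomial (hp ord0 (lift ord0 q)) (leq0n _)).
  by rewrite /monomial_ip /= mul0r mulr0.
rewrite CintegralZ ?Cintegral_monomial//; last exact: Cintegrable_monomial.
by rewrite /monomial_ip bin0 divr1 mulr1.
Qed.

Lemma ipH_Jk mu nu k (F : R[i] -> R[i] -> R[i]) : inTensor mu nu F -> (k <= mu)%N -> (k <= nu)%N ->
  ipH (mu + nu - 2 * k) (Jk mu nu k F) (fun=> 1) = Jk mu nu k F 0.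
Proof.
move=> tF km kn.
rewrite (@ipH_const _ (mu - k) (nu - k)
   (fun p q => 'C(mu - k, p)%:R * 'C(nu - k, q)%:R * Jcoef mu nu k F p q)).
- by rewrite Jk0 !bin0 !mul1r.
- by lia.
- by move=> xi; exact: JkE.
Qed.

(** * The function (z - w)^k and its norm *)

Definition diffpow k (z w : R[i]) : R[i] := (z - w) ^+ k.

Lemma ipT_diffpow mu nu k (F : R[i] -> R[i] -> R[i]) : ipT mu nu F (diffpow k) = Jk mu nu k F 0.
Proof.
apply: eq_c2int => z w; rewrite !mul0r !addr0 !expr1n !mulr1.
by rewrite /diffpow rmorphXn rmorphB.
Qed.

Lemma inTensor_diffpow mu nu k : (k <= mu)%N -> (k <= nu)%N -> inTensor (R := R) mu nu (diffpow k).
Proof.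
move=> km kn.
exists (\matrix_(i, j) (if (i + j == k)%N then signed_bin k j else 0)) => z w.
rewrite /diffpow exprB_signed_bin exchange_big /=.
(* The range l <= k is widened to j <= nu, using k <= nu. In column j <= k only the row i = k - j
   contributes, and it exists since k <= mu. *)
rewrite (big_ord_widen_cond nu.+1 xpredT (fun l => signed_bin k l * (z ^+ (k - l) * w ^+ l)))//.
rewrite big_mkcond /=; apply: eq_bigr => j _; rewrite ltnS.
case: ifP => jk; last first.
  by rewrite big1// => i _; rewrite mxE ifF ?mul0r//; apply/negP => /eqP ijk; rewrite -ijk leq_addl in jk.
have h : (k - j < mu.+1)%N by lia.
rewrite (bigD1 (Ordinal h)) //= mxE /= subnK// eqxx big1 ?addr0 ?mulrA// => i ni.
rewrite mxE ifF ?mul0r//; apply/negP => /eqP ijk; move/eqP: ni; apply.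
by apply: val_inj => /=; rewrite -ijk addnK.
Qed.

(** The value is the squared norm of (z - w)^k: both factors are expanded, orthogonality in w
    removes the terms with l different from l', and the signs square to 1. *)
Lemma Jk_diffpow mu nu k : (k <= mu)%N -> (k <= nu)%N ->
  Jk mu nu k (diffpow k) 0 =
  \sum_(l < k.+1) 'C(k, l)%:R ^+ 2 / ('C(mu, k - l)%:R * 'C(nu, l)%:R).
Proof.
move=> km kn; rewrite -ipT_diffpow /ipT.
have mm (l l' : 'I_k.+1) := @c2int_bimonomial mu nu (k - l) (k - l') l l'.
have {}mm (l l' : 'I_k.+1) : c2integrable mu nu (bimonomial (k - l) (k - l') l l') /\
   c2int mu nu (bimonomial (k - l) (k - l') l l') = monomial_ip mu (k - l)%N (k - l')%N * monomial_ip nu l l'.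
  by have := ltn_ord l; have := ltn_ord l'; rewrite !ltnS => ? ?; apply: mm; lia.
rewrite (@eq_c2int _ _ _ (fun z w => \sum_(l < k.+1) \sum_(l' < k.+1)
   (signed_bin k l * signed_bin k l') * bimonomial (k - l) (k - l') l l' z w)); last first.
  move=> z w; rewrite /diffpow rmorphXn rmorphB !exprB_signed_bin mulr_suml; apply: eq_bigr => l _.
  by rewrite mulr_sumr; apply: eq_bigr => l' _; rewrite /bimonomial; ring.
rewrite c2int_sum; last by move=> l; apply: c2integrable_sum => l'; apply/c2integrableZ/(mm l l').1.
apply: eq_bigr => l _.
rewrite c2int_sum; last by move=> l'; apply/c2integrableZ/(mm l l').1.
rewrite (bigD1 l)//= big1 ?addr0; last first.
  move=> l' ll'; rewrite c2intZ ?(mm l l').2; last exact: (mm l l').1.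
  rewrite /monomial_ip [(l == l' :> nat)]eq_sym.
  by rewrite [(l' == l :> nat)](negbTE ll') !mul0r !mulr0.
rewrite c2intZ ?(mm l l).2; last exact: (mm l l).1.
have -> : signed_bin k l * signed_bin k l = 'C(k, l)%:R ^+ 2.
  by rewrite /signed_bin -mulr_natl mulrACA -!expr2 sqrr_sign mulr1.
by rewrite /monomial_ip !eqxx !mul1r -invfM.
Qed.

(** Needed because the adjoint equation has G as second argument, while [ipT_diffpow] has it as
    first. Expansion into monomials supplies the integrability required to conjugate the
    integral. *)
Lemma ipT_sym mu nu (F G : R[i] -> R[i] -> R[i]) : inTensor mu nu F -> inTensor mu nu G ->
  ipT mu nu G F = ((ipT mu nu F G)^*)%R.
Proof.
move=> [a aE] [b bE]; rewrite /ipT -c2int_conj.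
  by apply: eq_c2int => z w; rewrite rmorphM mulrC; congr (_ * _); exact: (esym (conjCK _)).
apply: (@eq_c2integrable _ _ (fun z w => \sum_(i < mu.+1) \sum_(j < nu.+1)
   \sum_(i' < mu.+1) \sum_(j' < nu.+1)
   (a i j * ((b i' j')^*)%R) * bimonomial i i' j j' z w)); last first.
  do 4 (apply: c2integrable_sum => ?); apply: c2integrableZ.
  by apply: (c2int_bimonomial _ _ _ _).1; rewrite -ltnS.
move=> z w; rewrite aE bE mulr_suml; apply: eq_bigr => i _.
rewrite mulr_suml; apply: eq_bigr => j _.
rewrite rmorph_sum mulr_sumr; apply: eq_bigr => i' _.
rewrite rmorph_sum mulr_sumr; apply: eq_bigr => j' _.
rewrite !rmorphM !rmorphXn /bimonomial; ring.
Qed.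

End Main.

(** * The value of J_k applied to the adjoint image of 1 *)

Theorem mainTheorem1 (R : realType) (mu nu k : nat) :
  (k <= mu)%N -> (mu < nu)%N ->
  (exists G : R[i] -> R[i] -> R[i], isJkAdj mu nu k (fun _ => 1) G) /\
  forall G : R[i] -> R[i] -> R[i], isJkAdj mu nu k (fun _ => 1) G ->
    Jk mu nu k G 0 =
      (k`!)%:R * rising ((mu + nu - 2 * k + 2)%:R) k
        / (rising (- (nu%:R)) k * rising (- (mu%:R)) k).
Proof.
move=> km mn; have kn : (k <= nu)%N by lia.
have tdiff := @inTensor_diffpow R _ _ _ km kn.
split.
  by exists (diffpow k); split=> // F tF; rewrite ipT_diffpow ipH_Jk.
move=> G [tG adjG].
(* For any such G, J_k G at 0 is the pairing of G with (z - w)^k, hence the conjugate of the pairing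
   of (z - w)^k with G; the adjoint equation turns the latter into J_k((z - w)^k) at 0. *)
rewrite -ipT_diffpow (ipT_sym tdiff tG) adjG// ipH_Jk// Jk_diffpow// -sum_bin_norm// rmorph_sum.
(* The summands are quotients of natural numbers, so conjugation fixes them. *)
by apply: eq_bigr => l _; rewrite fmorph_div rmorphXn rmorphM !rmorph_nat.
Qed.
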